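(* Let $\mathcal B=(\mathcal B_{r,s})_{r,s\ge0}$ be a banded infinite matrix defining a bounded operator on $\ell^2$. Assume that $\mathcal B$ has a right limit $\mathcal B^R$ along a subsequence $\{n_j\}_j$. Then $$\lim_{j\to\infty}\exp(-z\operatorname{Tr}\mathcal BP_{n_j})\det\big(1+(e^{z\mathcal B}-1)P_{n_j}\big)=\lim_{M\to\infty}\exp(-z\operatorname{Tr}\mathcal B^R_MP_-)\det\big(1+(e^{z\mathcal B^R_M}-1)P_-\big),$$ uniformly for $z$ in a sufficiently small neighborhood of the origin. In particular both limits exist and are analytic in a neighborhood of the origin.
   Context: $\mathcal B^R=(\mathcal B^R_{r,s})_{r,s\in\mathbb Z}$ is a right limit of $\mathcal B$ along $\{n_j\}$ if $\mathcal B^R_{r,s}=\lim_j\mathcal B_{n_j+r,n_j+s}$ for all $r,s\in\mathbb Z$ and $\mathcal B^R$ is bounded on $\ell^2(\mathbb Z)$. $\mathcal B^R_M$ equals $\mathcal B^R_{r,s}$ for $r,s\in\{-M,\dots,M\}$ and $0$ otherwise. $P_n$ is the projection onto the coordinates $0,\dots,n-1$; $P_-$ is the projection on $\ell^2(\mathbb Z)$ onto coordinates $r<0$. Determinants are Fredholm determinants. *)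

(* Defs.v *)
From HB Require Import structures.
From mathcomp Require Import all_boot all_order all_algebra.
From mathcomp Require Import all_classical all_reals all_analysis.
From mathcomp Require Import complex.
Import Order.TTheory GRing.Theory Num.Theory.
Import numFieldTopology.Exports numFieldNormedType.Exports.

Set Implicit Arguments.
Unset Strict Implicit.
Unset Printing Implicit Defensive.

Local Open Scope classical_set_scope.
Local Open Scope ring_scope.

Definition Cpx (R : realType) : numClosedFieldType := R[i].

Section Defs.
Variable R : realType.
Local Notation C := (Cpx R).

Definition cexp (w : C) : C :=
  limn (fun K => \sum_(k < K) w ^+ k / (k`!)%:R).

Definition banded (B : nat -> nat -> C) (b : nat) : Prop :=
  forall r s : nat, ((r + b < s)%N \/ (s + b < r)%N) -> B r s = 0.

(* the matrix defines a bounded operator on l^2(N): uniform bound of the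
   operator on finitely supported vectors (a dense subspace) *)
Definition bounded_nat (B : nat -> nat -> C) : Prop :=
  exists K : C, forall (m n : nat) (x : nat -> C),
    \sum_(r < m) `| \sum_(s < n) B r s * x s | ^+ 2
      <= K * \sum_(s < n) `| x s | ^+ 2.

Definition nmul (A B : nat -> nat -> C) (r s : nat) : C :=
  limn (fun N => \sum_(t < N) A r t * B t s).

Fixpoint npow (B : nat -> nat -> C) (k : nat) : nat -> nat -> C :=
  match k with
  | 0 => fun r s => (r == s)%:R
  | k.+1 => nmul B (npow B k)
  end.

Definition nexp (B : nat -> nat -> C) (z : C) (r s : nat) : C :=
  limn (fun K => \sum_(k < K) z ^+ k / (k`!)%:R * npow B k r s).

Definition zrange (m : nat) : seq int :=
  [seq (i%:Z - m%:Z) | i <- iota 0 (2 * m).+1].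

Definition negrange (m : nat) : seq int :=
  [seq (- (i.+1)%:Z) | i <- iota 0 m].

Definition bounded_int (A : int -> int -> C) : Prop :=
  exists K : C, forall (m n : nat) (x : int -> C),
    \sum_(r <- zrange m) `| \sum_(s <- zrange n) A r s * x s | ^+ 2
      <= K * \sum_(s <- zrange n) `| x s | ^+ 2.

Definition Bext (B : nat -> nat -> C) (r s : int) : C :=
  match r, s with
  | Posz a, Posz c => B a c
  | _, _ => 0
  end.

Definition right_limit (B : nat -> nat -> C) (n : nat -> nat)
    (BR : int -> int -> C) : Prop :=
  (forall r s : int,
      (fun j => Bext B ((n j)%:Z + r) ((n j)%:Z + s)) @ \oo --> BR r s)
  /\ bounded_int BR.

Definition trunc (A : int -> int -> C) (M : nat) (r s : int) : C :=
  if ((r \in zrange M) && (s \in zrange M)) then A r s else 0.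

(* powers and exponential of the (finitely supported) truncation; the
   product sums are exact since trunc A M vanishes outside {-M..M}^2 *)
Fixpoint zpow (A : int -> int -> C) (M : nat) (k : nat) : int -> int -> C :=
  match k with
  | 0 => fun r s => (r == s)%:R
  | k.+1 => fun r s => \sum_(t <- zrange M) trunc A M r t * zpow A M k t s
  end.

Definition zexpM (A : int -> int -> C) (M : nat) (z : C) (r s : int) : C :=
  limn (fun K => \sum_(k < K) z ^+ k / (k`!)%:R * zpow A M k r s).

(* det(1 + K), for an operator K whose matrix has all its nonzero columns
   among the (distinct) indices listed in S.  Then 1 + K is block-triangular
   w.r.t. span(S) (+) span(S)^perp, and its Fredholm determinant is the
   ordinary determinant of the compression 1 + P_S K P_S. *)
Definition fdet1 (I : eqType) (K : I -> I -> C) (S : seq I) : C :=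
  \det (\matrix_(i < size S, j < size S)
          ((i == j)%:R + K (tnth (in_tuple S) i) (tnth (in_tuple S) j))).

Definition lhs_term (B : nat -> nat -> C) (n : nat) (z : C) : C :=
  cexp (- z * \sum_(r < n) B r r) *
  fdet1 (fun r s : nat => (nexp B z r s - (r == s)%:R) * (s < n)%:R)
        (iota 0 n).

Definition rhs_term (BR : int -> int -> C) (M : nat) (z : C) : C :=
  cexp (- z * \sum_(r <- negrange M) trunc BR M r r) *
  fdet1 (fun r s : int => (zexpM BR M z r s - (r == s)%:R) * ((s < 0)%R : bool)%:R)
        (negrange M).

Definition unif_cvg_on (D : set C) (F : nat -> C -> C) (L : C -> C) : Prop :=
  forall e : C, 0 < e -> exists N : nat, forall j : nat, (N <= j)%N ->
    forall z, D z -> `| F j z - L z | < e.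

Definition analytic_on (D : set C) (f : C -> C) : Prop :=
  forall z0, D z0 -> exists rho : C, 0 < rho /\
    exists a : nat -> C, forall z, `| z - z0 | < rho ->
      (fun K => \sum_(k < K) a k * (z - z0) ^+ k) @ \oo --> f z.

Definition cball0 (eps : C) : set C := [set z | `| z | < eps].

End Defs.

(* Main.v *)
Require Import Defs.
From HB Require Import structures.
From mathcomp Require Import all_boot all_order all_algebra.
From mathcomp Require Import all_classical all_reals all_analysis.
From mathcomp Require Import complex.
From mathcomp Require Import perm ring zify.
Import Order.TTheory GRing.Theory Num.Theory.
Import numFieldTopology.Exports numFieldNormedType.Exports.
Local Open Scope classical_set_scope.
Local Open Scope ring_scope.

Set Implicit Arguments.
Unset Strict Implicit.
Unset Printing Implicit Defensive.

(* After translating the indices by n_j, both sides have the form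
   F(z) = exp(-z Tr PAP) det(P e^(zA) P) with P = P_-, Q = 1 - P_- and a banded
   matrix A: a translate of B on the left, a truncation of B^R on the right,
   and both families converge entrywise to B^R.  The matrix
   G = Q e^(zA) P (P e^(zA) P)^-1 satisfies the Riccati equation
   G' = QAP + QAQ G - G PAP - G PAQ G, G(0) = 0, and Jacobi's formula gives
   F' = Tr(PAQ G) F, F(0) = 1.  These equations determine the Taylor coefficients
   of F recursively from finitely many entries of A near the cut, so the
   coefficients depend continuously on A entrywise; the quadratic recursion also
   bounds the m-th one by D^m, where D depends only on the band width and on
   the sup of the entries.  Dominated convergence of the power series concludes. *)

(** The size of the determinants and Tr PAP both grow with [n_j] and [M]. The growth cancels
    exactly: the logarithmic derivative of det(P e^(zA) P) is Tr PAP + Tr(PAQ G), the prefactor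
    removes the first term, and the band confines the second to a [b] by [b] block at the cut. The
    inverse inside G is never formed. The identities are proved between formal power series, where G
    is defined by its recursion, Q e^(zA) P = G P e^(zA) P is deduced from uniqueness for a linear
    system, and the adjugate replaces the inverse in Jacobi's formula. The way back to values is
    that, for a fixed size, all matrix entries are entire series, and evaluating entire series
    respects sums and products, hence determinants. So the series of F sums to the determinant term
    at every z; the bound D^m, uniform in the size, is what the limits and analyticity rest on.
    [fps] is a record so that the Cauchy product does not compete with the pointwise structure on
    functions. *)

Record fps (K : Type) := Fps { fcoef : nat -> K }.

HB.instance Definition _ (K : Type) := gen_eqMixin (fps K).
HB.instance Definition _ (K : Type) := gen_choiceMixin (fps K).

Lemma fpsP (K : Type) (a b : fps K) : fcoef a =1 fcoef b -> a = b.
Proof. by case: a b => [a] [b] /= /funext ->. Qed.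

(** * Formal power series *)

Section PowerSeries.
Variable K : comNzRingType.
Implicit Types a b c : fps K.

Definition fps_const (x : K) : fps K := Fps (fun k => if k is 0%N then x else 0).
Definition fps_opp a := Fps (fun k => - fcoef a k).
Definition fps_add a b := Fps (fun k => fcoef a k + fcoef b k).
Definition fps_mul a b :=
  Fps (fun k => \sum_(i < k.+1) fcoef a i * fcoef b (k - i)%N).

Definition fps_trunc (n : nat) a : {poly K} := \poly_(i < n) fcoef a i.

Lemma coef_fps_trunc n a k :
  (k < n)%N -> (fps_trunc n a)`_k = fcoef a k.
Proof. by move=> kn; rewrite coef_poly kn. Qed.

(** Coefficient k of a product sees only coefficients up to k of the factors. The ring laws and the
    Leibniz rule are thereby inherited from polynomials. *)
Lemma fps_mul_trunc n a b k : (k < n)%N ->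
  fcoef (fps_mul a b) k = (fps_trunc n a * fps_trunc n b)`_k.
Proof.
move=> kn; rewrite coefM /=; apply: eq_bigr => i _.
rewrite !coef_fps_trunc //; first exact: leq_ltn_trans (leq_subr _ _) kn.
by apply: leq_ltn_trans kn; rewrite -ltnS.
Qed.

Lemma coef_mul_eq (p p' q q' : {poly K}) k :
  (forall i, (i <= k)%N -> p`_i = p'`_i) ->
  (forall i, (i <= k)%N -> q`_i = q'`_i) -> (p * q)`_k = (p' * q')`_k.
Proof.
move=> pp' qq'; rewrite !coefM; apply: eq_bigr => i _.
by rewrite pp' ?qq' ?leq_subr // -ltnS.
Qed.

Fact fps_addA : associative fps_add.
Proof. by move=> a b c; apply: fpsP => k /=; rewrite addrA. Qed.
Fact fps_addC : commutative fps_add.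
Proof. by move=> a b; apply: fpsP => k /=; rewrite addrC. Qed.
Fact fps_add0 : left_id (fps_const 0) fps_add.
Proof. by move=> a; apply: fpsP => -[|k] /=; rewrite add0r. Qed.
Fact fps_addN : left_inverse (fps_const 0) fps_opp fps_add.
Proof. by move=> a; apply: fpsP => -[|k] /=; rewrite addNr. Qed.

HB.instance Definition _ :=
  GRing.isZmodule.Build (fps K) fps_addA fps_addC fps_add0 fps_addN.

Fact fps_mulC : commutative fps_mul.
Proof.
by move=> a b; apply: fpsP => k; rewrite !(@fps_mul_trunc k.+1) // mulrC.
Qed.
Fact fps_mulA : associative fps_mul.
Proof.
move=> a b c; apply: fpsP => k; rewrite !(@fps_mul_trunc k.+1) //.
transitivity ((fps_trunc k.+1 a * fps_trunc k.+1 b * fps_trunc k.+1 c)`_k).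
  rewrite -mulrA; apply: coef_mul_eq => // i ik.
  by rewrite coef_fps_trunc // (@fps_mul_trunc k.+1).
apply: coef_mul_eq => // i ik.
by rewrite coef_fps_trunc // (@fps_mul_trunc k.+1).
Qed.
Fact fps_mul1 : left_id (fps_const 1) fps_mul.
Proof.
move=> a; apply: fpsP => k /=; rewrite big_ord_recl /= mul1r subn0.
by rewrite big1 ?addr0 // => i _; rewrite mul0r.
Qed.
Fact fps_mulDl : left_distributive fps_mul fps_add.
Proof.
move=> a b c; apply: fpsP => k /=; rewrite -big_split /=.
by apply: eq_bigr => i _; rewrite mulrDl.
Qed.
Fact fps_1neq0 : fps_const 1 != 0.
Proof.
by apply/eqP => /(congr1 (fun a => fcoef a 0)) /eqP; rewrite /= oner_eq0.
Qed.

HB.instance Definition _ := GRing.Zmodule_isComNzRing.Build (fps K)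
  fps_mulA fps_mulC fps_mul1 fps_mulDl fps_1neq0.

Lemma fcoefD a b k : fcoef (a + b) k = fcoef a k + fcoef b k.
Proof. by []. Qed.
Lemma fcoefN a k : fcoef (- a) k = - fcoef a k.
Proof. by []. Qed.
Lemma fcoefB a b k : fcoef (a - b) k = fcoef a k - fcoef b k.
Proof. by []. Qed.
Lemma fcoef0 k : fcoef (0 : fps K) k = 0.
Proof. by case: k. Qed.
Lemma fcoefM a b k :
  fcoef (a * b) k = \sum_(i < k.+1) fcoef a i * fcoef b (k - i)%N.
Proof. by []. Qed.
Lemma fcoefM0 a b : fcoef (a * b) 0 = fcoef a 0 * fcoef b 0.
Proof. by rewrite fcoefM big_ord_recl big_ord0 addr0. Qed.
Lemma fcoef_constM x a k : fcoef (fps_const x * a) k = x * fcoef a k.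
Proof.
rewrite fcoefM big_ord_recl subn0 big1 ?addr0 // => i _ /=.
by rewrite mul0r.
Qed.
Lemma fcoef_Mconst x a k : fcoef (a * fps_const x) k = fcoef a k * x.
Proof. by rewrite mulrC fcoef_constM mulrC. Qed.
Lemma fcoef_sum (I : Type) (r : seq I) (P : pred I) (F : I -> fps K) k :
  fcoef (\sum_(i <- r | P i) F i) k = \sum_(i <- r | P i) fcoef (F i) k.
Proof. by apply: (big_morph (fun a => fcoef a k)) => //; rewrite fcoef0. Qed.

Lemma fcoefM_eq0 a b k : (forall i, (i <= k)%N -> fcoef b i = 0) ->
  fcoef (a * b) k = 0.
Proof.
by move=> b0; rewrite fcoefM big1 // => i _; rewrite b0 ?mulr0 ?leq_subr.
Qed.

Lemma fps_constD x y : fps_const (x + y) = fps_const x + fps_const y.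
Proof. by apply: fpsP => -[|k] //=; rewrite addr0. Qed.
Lemma fps_constN x : fps_const (- x) = - fps_const x.
Proof. by apply: fpsP => -[|k] //=; rewrite oppr0. Qed.
Lemma fps_const_sum (I : Type) (r : seq I) (P : pred I) (F : I -> K) :
  fps_const (\sum_(i <- r | P i) F i) = \sum_(i <- r | P i) fps_const (F i).
Proof.
apply: (big_morph fps_const) => [x y|]; first exact: fps_constD.
by apply: fpsP => -[|k].
Qed.

(** Evaluation at z = 0, packaged as a ring morphism so that it commutes with determinants. *)
Definition fps_head a := fcoef a 0.
Fact fps_head_additive : zmod_morphism fps_head.
Proof. by []. Qed.
Fact fps_head_multiplicative : monoid_morphism fps_head.
Proof. by split=> // a b; exact: fcoefM0. Qed.
HB.instance Definition _ :=
  GRing.isZmodMorphism.Build (fps K) K fps_head fps_head_additive.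
HB.instance Definition _ :=
  GRing.isMonoidMorphism.Build (fps K) K fps_head fps_head_multiplicative.

Definition fps_deriv a := Fps (fun k => fcoef a k.+1 *+ k.+1).

Fact fps_deriv_additive : zmod_morphism fps_deriv.
Proof. by move=> a b; apply: fpsP => k /=; rewrite mulrnDl mulNrn. Qed.
HB.instance Definition _ :=
  GRing.isZmodMorphism.Build (fps K) (fps K) fps_deriv fps_deriv_additive.

Lemma fps_derivM a b :
  fps_deriv (a * b) = fps_deriv a * b + a * fps_deriv b.
Proof.
apply: fpsP => k; rewrite fcoefD !(@fps_mul_trunc k.+1) //=.
(* Differentiation reads one coefficient further, hence truncation at [k.+2]. *)
have -> : \sum_(i < k.+2) fcoef a i * fcoef b (k.+1 - i) =
          (fps_trunc k.+2 a * fps_trunc k.+2 b)`_k.+1.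
  by rewrite -fps_mul_trunc.
rewrite -coef_deriv derivM coefD; congr (_ + _); apply: coef_mul_eq => i ik.
- by rewrite coef_deriv !coef_fps_trunc.
- by rewrite !coef_fps_trunc // ltnS ltnW.
- by rewrite !coef_fps_trunc // ltnS ltnW.
- by rewrite coef_deriv !coef_fps_trunc.
Qed.

End PowerSeries.

(** * Derivations of a commutative ring and Jacobi's formula *)

Section Derivation.
Variables (S : comNzRingType) (d : {additive S -> S}).
Hypothesis dM : forall a b, d (a * b) = d a * b + a * d b.

Lemma derivation_mulmx (m n p : nat) (A : 'M[S]_(m, n)) (B : 'M[S]_(n, p)) :
  map_mx d (A *m B) = map_mx d A *m B + A *m map_mx d B.
Proof.
apply/matrixP => i j; rewrite !mxE raddf_sum -big_split /=.
by apply: eq_bigr => k _; rewrite !mxE dM.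
Qed.

Lemma derivation1 : d 1 = 0.
Proof.
have := dM 1 1; rewrite !mul1r mulr1 => /eqP.
by rewrite -subr_eq0 opprD addrA subrr sub0r oppr_eq0 => /eqP.
Qed.

Lemma derivation_sign (k : nat) : d ((-1) ^+ k) = 0.
Proof.
by rewrite -signr_odd; case: odd; rewrite ?raddfN /= derivation1 ?oppr0.
Qed.

Lemma derivation_prod (I : finType) (F : I -> S) :
  d (\prod_i F i) = \sum_i \prod_k (if k == i then d (F k) else F k).
Proof.
have E (r : seq I) : uniq r -> d (\prod_(k <- r) F k) =
    \sum_(i <- r) \prod_(k <- r) (if k == i then d (F k) else F k).
  elim: r => [|x r IH] /=; first by rewrite !big_nil derivation1.
  move=> /andP[xr ur]; rewrite !big_cons dM IH // eqxx; congr (_ + _).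
    congr (_ * _); apply: eq_big_seq => k kr; case: eqP => // kx.
    by rewrite -kx kr in xr.
  rewrite mulr_sumr; apply: eq_big_seq => i ir; rewrite big_cons.
  by case: eqP => // xi; rewrite xi ir in xr.
exact/E/index_enum_uniq.
Qed.

(** Jacobi's formula: the Leibniz expansion gives a sum of determinants with one row differentiated,
    and expanding each along that row produces the cofactors. *)
Lemma derivation_det (n : nat) (X : 'M[S]_n) :
  d (\det X) = \tr (map_mx d X *m \adj X).
Proof.
transitivity (\sum_i \det (\matrix_(k, j)
    (if k == i then d (X k j) else X k j))).
  rewrite /determinant raddf_sum exchange_big /=; apply: eq_bigr => s _.
  rewrite dM derivation_sign mul0r add0r derivation_prod mulr_sumr.
  by apply: eq_bigr => i _; congr (_ * _); apply: eq_bigr => k _; rewrite mxE.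
rewrite /mxtrace; apply: eq_bigr => i _; rewrite (expand_det_row _ i) mxE.
apply: eq_bigr => j _; rewrite !mxE eqxx; congr (_ * _).
rewrite /cofactor; congr (_ * \det _); apply/matrixP => k l; rewrite !mxE.
by rewrite eq_sym (negbTE (neq_lift _ _)).
Qed.

End Derivation.

(** * Limits and power series over the complex numbers *)

Section Convergence.
Variable K : numFieldType.
Implicit Types (u v : nat -> K) (l e M : K).

Lemma cvgnP u l : u @ \oo --> l <->
  forall e, 0 < e -> exists N, forall n, (N <= n)%N -> `|u n - l| < e.
Proof.
split=> [/cvgrPdist_lt ul e e0|ul].
  have [N _ uN] := ul _ e0; exists N => n Nn.
  by rewrite distrC; exact: uN.
apply/cvgrPdist_lt => e e0; have [N uN] := ul _ e0.
by exists N => // n /= Nn; rewrite distrC uN.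
Qed.

Lemma cvgn_lim u l : u @ \oo --> l -> limn u = l.
Proof. exact: cvg_lim. Qed.

Lemma cvgn_sum (I : Type) (r : seq I) (P : pred I) (F : nat -> I -> K)
    (l : I -> K) :
  (forall i, (fun n => F n i) @ \oo --> l i) ->
  (fun n => \sum_(i <- r | P i) F n i) @ \oo --> \sum_(i <- r | P i) l i.
Proof.
move=> Fl; elim: r => [|i r IH].
  rewrite big_nil; apply: cvg_near_cst; apply: nearW => n.
  by rewrite big_nil.
rewrite big_cons; under eq_fun do rewrite big_cons.
by case: ifP => _ //; apply: cvgD.
Qed.

(** The order of [K] is partial, but [|l|] and [M] are both real, hence comparable, and the usual
    argument by contradiction applies. *)
Lemma cvgn_norm_le u l M N :
  u @ \oo --> l -> (forall n, (N <= n)%N -> `|u n| <= M) -> `|l| <= M.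
Proof.
move=> /cvgnP ul uM; have M0 := le_trans (normr_ge0 _) (uM N (leqnn N)).
have [//|Ml] := real_leP (normr_real l) (ger0_real M0).
have [|n1 un1] := ul (`|l| - M); first by rewrite subr_gt0.
have := un1 _ (leq_maxl n1 N); rewrite ltrBrDr => ltl.
have : `|l| < `|l|; last by rewrite ltxx.
apply: le_lt_trans ltl; apply: le_trans (lerD (lexx _) (uM _ (leq_maxr n1 N))).
by rewrite distrC -{1}(subrK (u (maxn n1 N)) l) ler_normD.
Qed.

Lemma cvgn_dist_le u l M N : u @ \oo --> l ->
  (forall n, (N <= n)%N -> `|u n - u N| <= M) -> `|u N - l| <= M.
Proof.
move=> ul uM; rewrite distrC.
apply: (@cvgn_norm_le (fun n => u n - u N) _ _ N) => //.
by apply: cvgB => //; exact: cvg_cst.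
Qed.

Lemma cvgn_eq_near u v l N :
  (forall n, (N <= n)%N -> u n = v n) -> v @ \oo --> l -> u @ \oo --> l.
Proof.
move=> uv /cvgnP vl; apply/cvgnP => e /vl [N' vN]; exists (maxn N N') => n.
by rewrite geq_max => /andP[Nn N'n]; rewrite uv ?vN.
Qed.

Lemma cvgn_eventually_cst u l N :
  (forall n, (N <= n)%N -> u n = l) -> u @ \oo --> l.
Proof. by move=> ul; apply: (cvgn_eq_near (v := fun=> l) ul); apply: cvg_cst. Qed.

Lemma half_sum_le (m n : nat) :
  \sum_(m <= k < n) (2^-1 : K) ^+ k <= 2 * 2^-1 ^+ m.
Proof.
have h0 k : 0 <= (2^-1 : K) ^+ k by rewrite exprn_ge0 // invr_ge0 ler0n.
have [mn|nm] := leqP m n; last first.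
  by rewrite big_geq ?mulr_ge0 ?ler0n // ltnW.
suff : \sum_(m <= k < n) (2^-1 : K) ^+ k = 2 * 2^-1 ^+ m - 2 * 2^-1 ^+ n.
  by move->; rewrite gerBl mulr_ge0.
elim: n mn => [|n IH].
  by rewrite leqn0 => /eqP ->; rewrite big_geq // subrr.
rewrite leq_eqVlt => /orP[/eqP <-|]; first by rewrite big_geq // subrr.
rewrite ltnS => mn; rewrite big_nat_recr //= IH //.
rewrite exprS mulrA divff ?pnatr_eq0 // mul1r.
by ring.
Qed.

End Convergence.

(** * Geometrically dominated complex series *)

Section ComplexSeries.
Variable R : realType.
Local Notation C := (Cpx R).

(** A positive complex number is real, so this is the Archimedean property of [R]. Later sections
    over a general field assume it in this form, as [half_small]. *)
Lemma half_pow_lt (e : C) : 0 < e -> exists K, (2^-1 : C) ^+ K < e.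
Proof.
case: e => x y; rewrite ltcE /= => /andP[/eqP -> x0].
exists (Num.Def.archi_bound x^-1); set k := Num.Def.archi_bound _.
have := upper_nthrootP (leqnn k); rewrite -ltcR => H.
rewrite exprVn -[ltRHS]invrK ltf_pV2 ?posrE ?exprn_gt0 ?ltr0n //; last first.
  by rewrite invr_gt0 ltcE /= eqxx.
apply: le_lt_trans (lt_le_trans H _).
  by rewrite fmorphV.
by rewrite rmorphXn rmorph_nat.
Qed.

Lemma normc_ge_Im (x : C) : (`|complex.Im x|)%:C%C <= `|x|.
Proof.
have := normc_ge_Re ('i%C * x : R[i]); rewrite normrM.
have -> : `|'i%C : R[i]| = 1 by rewrite normc_def /= expr0n /= add0r expr1n sqrtr1.
by rewrite mul1r; case: x => a b /=; rewrite !mul0r mul1r sub0r normrN.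
Qed.

Lemma cvgn_complex (a b : nat -> R) (x y : R) :
  a @ \oo --> x -> b @ \oo --> y ->
  (fun n => (a n +i* b n)%C : C) @ \oo --> ((x +i* y)%C : C).
Proof.
move=> /cvgnP ax /cvgnP bY; apply/cvgnP => -[e1 e2].
rewrite ltcE /= => /andP[/eqP -> e0].
have e20 : 0 < e1 / 2 by rewrite divr_gt0.
have [N1 aN] := ax _ e20; have [N2 bN] := bY _ e20.
exists (maxn N1 N2) => n; rewrite geq_max => /andP[N1n N2n].
have -> : ((a n +i* b n)%C - (x +i* y)%C : R[i]) =
    (a n - x)%:C%C + 'i%C * (b n - y)%:C%C.
  by apply/eqP; rewrite eq_complex /=; apply/andP; split; apply/eqP; ring.
apply: le_lt_trans (ler_normD _ _) _; rewrite normrM.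
have -> : `|'i%C : R[i]| = 1 by rewrite normc_def /= expr0n /= add0r expr1n sqrtr1.
rewrite mul1r !normc_def /= expr0n /= !addr0 !sqrtr_sqr.
by rewrite -raddfD ltcR [ltRHS]splitr ltrD ?aN ?bN.
Qed.

Lemma real_geo_cvg (u : nat -> R) (M : R) :
  (forall k, `|u k| <= M * 2^-1 ^+ k) ->
  exists l : R, (fun K => \sum_(k < K) u k) @ \oo --> l.
Proof.
move=> uM.
have : cvgn (series u).
  apply: normed_cvg; apply: (series_le_cvg (v_ := geometric M 2^-1)) => //.
    by move=> k; rewrite normr_ge0.
    by move=> k; exact: le_trans (normr_ge0 _) (uM k).
  by apply: is_cvg_geometric_series; rewrite ger0_norm ?invr_ge0 // invf_lt1 ?ltr1n.
rewrite /series /=; under eq_fun do rewrite big_mkord.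
by move=> cu; eexists; exact: cu.
Qed.

(** Completeness enters here, through the real and imaginary parts; the rate in the conclusion is
    the tail of the geometric majorant. *)
Lemma geo_cvg (u : nat -> C) (M : C) :
  (forall k, `|u k| <= M * 2^-1 ^+ k) ->
  exists l, (fun K => \sum_(k < K) u k) @ \oo --> l /\
    forall K, `|\sum_(k < K) u k - l| <= 2 * M * 2^-1 ^+ K.
Proof.
move=> uM.
(* [M] dominates the norm of [u 0], which forces its imaginary part to vanish. *)
have [m mM] : exists m : R, M = m%:C%C.
  have := le_trans (normr_ge0 _) (uM 0%N); rewrite mulr1.
  by case: M {uM} => m m'; rewrite lecE /= => /andP[/eqP -> _]; exists m.
have bound k : `|u k| <= (m * 2^-1 ^+ k)%:C%C.
  apply: le_trans (uM k) _.
  by rewrite mM rmorphM rmorphXn fmorphV rmorph_nat.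
have := @real_geo_cvg (fun k => complex.Re (u k)) m.
case=> [k|x rex]; first by rewrite -lecR (le_trans (normc_ge_Re _)).
have := @real_geo_cvg (fun k => complex.Im (u k)) m.
case=> [k|y imy]; first by rewrite -lecR (le_trans (normc_ge_Im _)).
exists (Complex x y); have cvgu := cvgn_complex rex imy.
have cvgl : (fun K => \sum_(k < K) u k) @ \oo --> (Complex x y : C).
  apply: (cvgn_eq_near (N := 0%N) _ cvgu) => n _.
  elim: n => [|n IH]; first by rewrite !big_ord0.
  by rewrite !big_ord_recr /= IH; case: (u n).
split=> // K; apply: (cvgn_dist_le cvgl).
move=> n Kn; rewrite -!(big_mkord xpredT u) (big_cat_nat _ Kn) //=.
rewrite addrAC subrr add0r; apply: le_trans (ler_norm_sum _ _ _) _.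
apply: le_trans (ler_sum _ (fun k _ => uM k)) _.
rewrite -mulr_sumr -mulrA mulrCA ler_wpM2l ?half_sum_le //.
by have := le_trans (normr_ge0 _) (uM 0%N); rewrite mulr1.
Qed.

End ComplexSeries.

(** * Evaluation of entire power series *)

Section EntireSeries.
Variable K : numFieldType.
Hypothesis half_small : forall e : K, 0 < e -> exists n, (2^-1 : K) ^+ n < e.
Implicit Types (a b : fps K) (x z : K).

Let half_ge0 k : 0 <= (2^-1 : K) ^+ k.
Proof. by rewrite exprn_ge0 // invr_ge0 ler0n. Qed.

Lemma cvgn_half_bound (u : nat -> K) (l M : K) :
  (forall n, `|u n - l| <= M * 2^-1 ^+ n) -> u @ \oo --> l.
Proof.
move=> uM; apply/cvgnP => e e0.
have M0 : 0 <= M by have := le_trans (normr_ge0 _) (uM 0%N); rewrite mulr1.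
have [n0 n0e] := @half_small (e / (M + 1)) (divr_gt0 e0 (ltr_wpDl M0 ltr01)).
exists n0 => n n0n; apply: le_lt_trans (uM n) _.
have h : (2^-1 : K) ^+ n <= 2^-1 ^+ n0.
  by rewrite ler_wiXn2l ?invr_ge0 ?ler0n // invf_le1 ?ltr0n ?ler1n.
apply: le_lt_trans (ler_wpM2l M0 h) _.
rewrite ltr_pdivlMr ?ltr_wpDl // in n0e; apply: le_lt_trans n0e.
by rewrite mulrC ler_wpM2l // lerDl ler01.
Qed.

(** Infinite radius of convergence, stated without series: applying the bound at a multiple of [x]
    yields geometric decay at [x]. *)
Definition entire a :=
  forall x, 0 < x -> exists M, forall k, `|fcoef a k| * x ^+ k <= M.

Lemma entireD a b : entire a -> entire b -> entire (a + b).
Proof.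
move=> ea eb x x0; have [M aM] := ea x x0; have [M' bM'] := eb x x0.
exists (M + M') => k; apply: le_trans (lerD (aM k) (bM' k)).
by rewrite -mulrDl ler_wpM2r ?ler_normD // exprn_ge0 ?ltW.
Qed.

Lemma entireN a : entire a -> entire (- a).
Proof.
move=> ea x x0; have [M aM] := ea x x0; exists M => k.
by rewrite fcoefN normrN.
Qed.

Lemma entire_const x : entire (fps_const x).
Proof.
move=> y y0; exists `|x| => -[|k] /=; first by rewrite mulr1.
by rewrite normr0 mul0r normr_ge0.
Qed.

(** Bounds at [2 * x] leave a spare factor 2^-k at [x], which absorbs the k + 1 terms of the Cauchy
    product. *)
Lemma conv_bound (a b : nat -> K) x M M' : 0 < x ->
  (forall k, `|a k| * (2 * x) ^+ k <= M) ->
  (forall k, `|b k| * (2 * x) ^+ k <= M') ->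
  forall k, `|\sum_(i < k.+1) a i * b (k - i)%N| * x ^+ k <= M * M'.
Proof.
move=> x0 aM bM k.
have y0 n : 0 <= (2 * x) ^+ n by rewrite exprn_ge0 // mulr_ge0 ?ler0n ?ltW.
have MM0 : 0 <= M * M'.
  have M0 : 0 <= M by apply: le_trans (aM 0%N); rewrite mulr_ge0.
  by apply: mulr_ge0 M0 _; apply: le_trans (bM 0%N); rewrite mulr_ge0.
have step (i : 'I_k.+1) :
    `|a i * b (k - i)%N| * x ^+ k <= M * M' * 2^-1 ^+ k.
  have ik : (i <= k)%N by rewrite -ltnS.
  have -> : `|a i * b (k - i)%N| * x ^+ k =
    (`|a i| * (2 * x) ^+ i) * (`|b (k - i)%N| * (2 * x) ^+ (k - i)) * 2^-1 ^+ k.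
    rewrite normrM mulrACA -exprD subnKC // -[RHS]mulrA; congr (_ * _).
    by rewrite exprMn mulrAC -exprMn mulfV ?pnatr_eq0 // expr1n mul1r.
  by apply: ler_wpM2r => //; apply: ler_pM; rewrite ?mulr_ge0.
apply: le_trans (_ : \sum_(i < k.+1) M * M' * 2^-1 ^+ k <= _); last first.
  rewrite sumr_const card_ord -[leRHS]mulr1 -mulrnAr ler_wpM2l //.
  rewrite -mulr_natr exprVn mulrC ler_pdivrMr ?exprn_gt0 ?ltr0n //.
  by rewrite mul1r -natrX ler_nat ltn_expl.
apply: le_trans (ler_wpM2r (exprn_ge0 _ (ltW x0)) (ler_norm_sum _ _ _)) _.
by rewrite mulr_suml; apply: ler_sum => i _; exact: step.
Qed.

Lemma entireM a b : entire a -> entire b -> entire (a * b).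
Proof.
move=> ea eb x x0; have y0 : 0 < 2 * x by rewrite mulr_gt0 ?ltr0n.
have [M aM] := ea _ y0; have [M' bM'] := eb _ y0; exists (M * M') => k.
by rewrite fcoefM conv_bound.
Qed.

Definition psum a z n := \sum_(k < n) fcoef a k * z ^+ k.

Definition evalto a z (v : K) := entire a /\ psum a z @ \oo --> v.

Lemma evaltoD a b z v w :
  evalto a z v -> evalto b z w -> evalto (a + b) z (v + w).
Proof.
move=> [ea av] [eb bw]; split; first exact: entireD.
apply: (cvgn_eq_near (N := 0%N) _ (cvgD av bw)) => n _.
by rewrite -[RHS]/(psum a z n + psum b z n) /psum -big_split /=; apply: eq_bigr => k _; rewrite -mulrDl.
Qed.

Lemma evaltoN a z v : evalto a z v -> evalto (- a) z (- v).
Proof.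
move=> [ea av]; split; first exact: entireN.
apply: (cvgn_eq_near (N := 0%N) _ (cvgN av)) => n _.
by rewrite -[RHS]/(- psum a z n) /psum -sumrN; apply: eq_bigr => k _; rewrite fcoefN mulNr.
Qed.

Lemma evalto_const x z : evalto (fps_const x) z x.
Proof.
split; first exact: entire_const.
apply: (cvgn_eventually_cst (N := 1%N)) => -[|n] // _.
by rewrite /psum big_ord_recl /= mulr1 big1 ?addr0 // => i _; rewrite mul0r.
Qed.

(** The difference consists of terms of degree n to 2n - 1 of the product of the truncations. Of the
    two doublings of [x], one is spent in [conv_bound], the other gives the decay 2^-k of these
    terms. *)
Lemma psumM a b z x M M' n : `|z| <= x -> 0 < x ->
  (forall k, `|fcoef a k| * (2 * (2 * x)) ^+ k <= M) ->
  (forall k, `|fcoef b k| * (2 * (2 * x)) ^+ k <= M') ->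
  `|psum (a * b) z n - psum a z n * psum b z n| <= 2 * (M * M') * 2^-1 ^+ n.
Proof.
move=> zx x0 aM bM.
set p := fps_trunc n a; set q := fps_trunc n b.
have pM k : `|p`_k| * (2 * (2 * x)) ^+ k <= M.
  rewrite coef_poly; case: ifP => _ //; rewrite normr0 mul0r.
  by apply: le_trans (aM k); rewrite mulr_ge0 ?exprn_ge0 // !mulr_ge0 ?ler0n ?ltW.
have qM k : `|q`_k| * (2 * (2 * x)) ^+ k <= M'.
  rewrite coef_poly; case: ifP => _ //; rewrite normr0 mul0r.
  by apply: le_trans (bM k); rewrite mulr_ge0 ?exprn_ge0 // !mulr_ge0 ?ler0n ?ltW.
have -> : psum a z n * psum b z n = (p * q).[z].
  by rewrite hornerM !horner_poly.
have spq : (size (p * q)%R <= n + n)%N.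
  apply: leq_trans (size_polyMleq _ _) _; apply: leq_trans (leq_pred _) _.
  by apply: leq_add; exact: size_poly.
rewrite (horner_coef_wide _ spq) -(big_mkord xpredT (fun k => (p * q)`_k * z ^+ k)).
rewrite (@big_cat_nat _ _ _ n) //= ?leq_addr //.
have -> : \sum_(0 <= k < n) (p * q)`_k * z ^+ k = psum (a * b) z n.
  rewrite big_mkord; apply: eq_bigr => k _; congr (_ * _).
  by rewrite -fps_mul_trunc.
rewrite opprD addrA subrr sub0r normrN.
apply: le_trans (ler_norm_sum _ _ _) _.
have x20 : 0 < 2 * x by rewrite mulr_gt0 ?ltr0n.
have MM0 : 0 <= M * M'.
  apply: le_trans (conv_bound x20 pM qM 0).
  by rewrite mulr_ge0.
apply: le_trans (_ : \sum_(n <= k < n + n) M * M' * 2^-1 ^+ k <= _); last first.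
  by rewrite -mulr_sumr [2 * (M * _)]mulrC -[leRHS]mulrA ler_wpM2l ?half_sum_le.
apply: ler_sum => k _; have := conv_bound x20 pM qM k; rewrite -coefM => H.
rewrite normrM normrX.
apply: le_trans (_ : `|(p * q)`_k| * x ^+ k <= _).
  by rewrite ler_wpM2l //; apply: lerXn2r; rewrite ?nnegrE ?(ltW x0).
rewrite exprVn ler_pdivlMr ?exprn_gt0 ?ltr0n //.
by apply: le_trans H; rewrite exprMn [2 ^+ k * _]mulrC mulrA.
Qed.

Lemma evaltoM a b z v w :
  evalto a z v -> evalto b z w -> evalto (a * b) z (v * w).
Proof.
move=> [ea av] [eb bw]; split; first exact: entireM.
have x0 : 0 < `|z| + 1 by rewrite ltr_wpDl.
have y0 : 0 < 2 * (2 * (`|z| + 1)) by rewrite !mulr_gt0 ?ltr0n.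
have [M aM] := ea _ y0; have [M' bM'] := eb _ y0.
have zx : `|z| <= `|z| + 1 by rewrite lerDl ler01.
have h0 : (fun n => psum (a * b) z n - psum a z n * psum b z n) @ \oo --> (0 : K).
  apply: (@cvgn_half_bound _ _ (2 * (M * M'))) => n.
  by rewrite subr0; exact: (psumM n zx).
rewrite -[v * w]add0r.
apply: (cvgn_eq_near (N := 0%N) _ (cvgD h0 (cvgM av bw))) => n _.
by rewrite -[RHS]/(_ - _ + _ * _) subrK.
Qed.

Lemma evalto_sum (I : Type) (r : seq I) (F : I -> fps K) (f : I -> K) z :
  (forall i, evalto (F i) z (f i)) ->
  evalto (\sum_(i <- r) F i) z (\sum_(i <- r) f i).
Proof.
move=> Ff; apply: (big_ind2 (fun a v => evalto a z v)) => //.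
  exact: (evalto_const 0).
by move=> *; exact: evaltoD.
Qed.

Lemma evalto_prod (I : Type) (r : seq I) (F : I -> fps K) (f : I -> K) z :
  (forall i, evalto (F i) z (f i)) ->
  evalto (\prod_(i <- r) F i) z (\prod_(i <- r) f i).
Proof.
move=> Ff; apply: (big_ind2 (fun a v => evalto a z v)) => //.
  exact: (evalto_const 1).
by move=> *; exact: evaltoM.
Qed.

Lemma evalto_det n (X : 'M[fps K]_n) (x : 'M[K]_n) z :
  (forall i j, evalto (X i j) z (x i j)) -> evalto (\det X) z (\det x).
Proof.
move=> Xx; apply: evalto_sum => s; apply: evaltoM; last first.
  by apply: evalto_prod => i.
rewrite -signr_odd -[in X in evalto _ _ X]signr_odd.
by case: odd; [apply: evaltoN|]; exact: (evalto_const 1).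
Qed.

Lemma entire_exp_bound a (c : K) : 0 <= c ->
  (forall e : K, 0 <= e -> exists n, e <= n%:R) ->
  (forall k, `|fcoef a k| <= c ^+ k / k`!%:R) -> entire a.
Proof.
move=> c0 arch ac x x0; have [m cm] := arch (c * x) (mulr_ge0 c0 (ltW x0)).
exists (m.+1 ^ m.+1)%:R => k.
(* Once k has reached [m.+1], each further factor of the factorial is at least [m.+1], so the ratio
   no longer grows. *)
have fact_bound : (m.+1 ^ k <= m.+1 ^ m.+1 * k`!)%N.
  elim: k => [|k IH]; first by rewrite fact0 muln1 expn_gt0.
  have [km|mk] := ltnP k m.+1.
    by apply: leq_trans (leq_pmulr _ (fact_gt0 _)); rewrite leq_pexp2l.
  by rewrite expnS factS mulnCA leq_mul // ltnW.
apply: le_trans (ler_wpM2r (exprn_ge0 _ (ltW x0)) (ac k)) _.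
rewrite mulrAC -exprMn ler_pdivrMr ?ltr0n ?fact_gt0 // -natrM.
apply: le_trans (_ : m.+1%:R ^+ k <= _); last by rewrite -natrX ler_nat.
rewrite lerXn2r ?nnegrE ?ler0n ?mulr_ge0 // ?ltW //.
by apply: le_lt_trans cm _; rewrite ltr_nat.
Qed.

End EntireSeries.

(** * The Riccati recursion *)

Section StrongRecursion.
Variables (T : Type) (x0 : T) (step : nat -> (nat -> T) -> T).

(** Course-of-values recursion: the table after m steps holds the values at all indices up to m,
    because the convolutions below read every earlier coefficient. *)
Fixpoint rec_table (m : nat) : nat -> T :=
  if m is m'.+1 then
    fun k => if (k <= m')%N then rec_table m' k else step m' (rec_table m')
  else fun=> x0.

Definition strong_rec (m : nat) : T := rec_table m m.

Lemma rec_table_stable m k : (k <= m)%N -> rec_table m k = strong_rec k.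
Proof.
elim: m => [|m IH]; first by rewrite leqn0 => /eqP ->.
rewrite leq_eqVlt => /orP[/eqP -> //|]; rewrite ltnS => km /=.
by rewrite km IH.
Qed.

Lemma strong_recS m :
  (forall u v, (forall k, (k <= m)%N -> u k = v k) -> step m u = step m v) ->
  strong_rec m.+1 = step m strong_rec.
Proof.
move=> loc; rewrite /strong_rec /= ltnn; apply: loc => k.
exact: rec_table_stable.
Qed.

End StrongRecursion.

Section Riccati.
Variable K : numFieldType.
Implicit Types (A : int -> int -> K) (b : nat).

(* [Negz i] is the index -(i+1): the arguments [Negz _] range over the
   coordinates of P_-, the nonnegative ones over those of Q = 1 - P_-.
   [riccati A b m] is the coefficient of z^m in
   G = Q e^(zA) P_- (P_- e^(zA) P_-)^-1, read off from
   G' = QAP_- + QAQ G - G P_-AP_- - G P_-AQ G; the sums are cut off at the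
   band width. *)
Definition riccati_step A b (m : nat) (g : nat -> nat -> nat -> K) (q i : nat) :=
  ((if m is 0%N then A q (Negz i) else 0)
   + \sum_(t < (q + b).+1) A q t * g m t i
   - \sum_(t < (i + b).+1) g m q t * A (Negz t) (Negz i)
   - \sum_(k < m.+1) \sum_(t < b) \sum_(u < b)
       g k q t * A (Negz t) u * g (m - k)%N u i) / m.+1%:R.

Definition riccati A b := strong_rec (fun _ _ => 0) (riccati_step A b).

(** The coefficient of z^m in Tr(PAQ G); only entries within [b] of the cut couple P to Q. *)
Definition trace_coef A b (m : nat) : K :=
  \sum_(t < b) \sum_(u < b) A (Negz t) u * riccati A b m u t.

Definition det_coef_step A b (m : nat) (f : nat -> K) : K :=
  (\sum_(k < m.+1) trace_coef A b k * f (m - k)%N) / m.+1%:R.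

Definition det_coef A b := strong_rec 1 (det_coef_step A b).

Lemma riccatiS A b m : riccati A b m.+1 = riccati_step A b m (riccati A b).
Proof.
apply: strong_recS => u v uv; apply/funext => q; apply/funext => i.
rewrite /riccati_step uv //; congr ((_ - _) / _).
apply: eq_bigr => k _; apply: eq_bigr => t _; apply: eq_bigr => s _.
by rewrite !uv ?leq_subr // -ltnS.
Qed.

Lemma det_coefS A b m : det_coef A b m.+1 = det_coef_step A b m (det_coef A b).
Proof.
apply: strong_recS => u v uv; rewrite /det_coef_step; congr (_ / _).
by apply: eq_bigr => k _; rewrite uv // leq_subr.
Qed.

(** Used to exchange the cutoff at the band width, which does not depend on the matrix size, for the
    cutoff at the matrix size. *)
Lemma sum_ord_cutoff (F : nat -> K) m n :
  (forall k, (minn m n <= k)%N -> F k = 0) ->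
  \sum_(k < m) F k = \sum_(k < n) F k.
Proof.
wlog mn : m n / (m <= n)%N => [H|].
  case/orP: (leq_total m n) => [|nm F0]; first exact: H.
  by apply/esym/H => // k; rewrite minnC; exact: F0.
rewrite (minn_idPl mn) => F0; rewrite -!(big_mkord xpredT F).
rewrite (big_cat_nat _ mn) //= [X in _ = _ + X]big1_seq ?addr0 // => k.
by rewrite mem_index_iota => /andP[_ /andP[mk _]]; rewrite F0.
Qed.

Definition banded_int A b := forall r s : int,
  (r + b%:Z < s) || (s + b%:Z < r) -> A r s = 0.

End Riccati.

Lemma subr_mxE (V : zmodType) m n (M M' : 'M[V]_(m, n)) i j :
  (M - M') i j = M i j - M' i j.
Proof. by rewrite !mxE. Qed.

(** * The compressed exponential as a matrix of power series *)

Section CompressedExponential.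
Variable K : numFieldType.
(** [E k] stands for the k-th power of [A]. Only its columns in P and the product rule split at the
    cut are assumed, so that the powers of a translate and of a truncation both fit. *)
Variables (A : int -> int -> K) (b N : nat) (E : nat -> int -> int -> K).
Hypothesis Aband : banded_int A b.
Hypothesis Arow0 : forall i s, (N <= i)%N -> A (Negz i) s = 0.
Hypothesis E0 : forall r s, E 0 r s = (r == s)%:R.
Hypothesis ES_neg : forall k (i j : 'I_N), E k.+1 (Negz i) (Negz j) =
  \sum_(t < N) A (Negz i) (Negz t) * E k (Negz t) (Negz j)
  + \sum_(u < b) A (Negz i) u * E k u (Negz j).
Hypothesis ES_pos : forall k (q : nat) (j : 'I_N), E k.+1 q (Negz j) =
  \sum_(t < N) A q (Negz t) * E k (Negz t) (Negz j)
  + \sum_(u < (q + b).+1) A q u * E k u (Negz j).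

Local Notation cst := (@fps_const K).
Local Notation deriv := (@fps_deriv K).

Definition fps_exp_entry (r s : int) : fps K := Fps (fun k => E k r s / k`!%:R).

(** [X] is P e^(zA) P. The range of Q is infinite-dimensional, so Q e^(zA) P, G and QAP are handled
    one row [q] at a time. *)
Let X : 'M[fps K]_N := \matrix_(i, j) fps_exp_entry (Negz i) (Negz j).
Let Y (q : nat) : 'rV[fps K]_N := \row_j fps_exp_entry q (Negz j).
Let G (q : nat) : 'rV[fps K]_N := \row_i Fps (fun m => riccati A b m q i).
Let PP : 'M[fps K]_N := \matrix_(i, j) cst (A (Negz i) (Negz j)).
Let PQ (u : nat) : 'cV[fps K]_N := \col_i cst (A (Negz i) u).
Let QP (q : nat) : 'rV[fps K]_N := \row_j cst (A q (Negz j)).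

Lemma coef_deriv_exp r s k :
  fcoef (deriv (fps_exp_entry r s)) k = E k.+1 r s / k`!%:R.
Proof.
rewrite /= factS -mulrnAr; congr (_ * _).
by rewrite natrM invfM -mulr_natl mulrA divff ?pnatr_eq0 // mul1r.
Qed.

Lemma deriv_X : map_mx deriv X = PP *m X + \sum_(u < b) PQ u *m Y u.
Proof.
apply/matrixP => i j; rewrite mxE [X i j]mxE; apply: fpsP => k.
rewrite coef_deriv_exp ES_neg mulrDl !mxE fcoefD summxE !fcoef_sum !mulr_suml.
congr (_ + _); apply: eq_bigr => t _; rewrite !mxE.
  by rewrite fcoef_constM mulrA.
by rewrite big_ord1 !mxE fcoef_constM mulrA.
Qed.

Lemma deriv_Y q : map_mx deriv (Y q) =
  QP q *m X + \sum_(t < (q + b).+1) cst (A q t) *: Y t.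
Proof.
apply/matrixP => i j; rewrite mxE [Y q i j]mxE; apply: fpsP => k.
rewrite coef_deriv_exp ES_pos mulrDl !mxE fcoefD summxE !fcoef_sum !mulr_suml.
by congr (_ + _); apply: eq_bigr => t _; rewrite !mxE fcoef_constM mulrA.
Qed.

Lemma deriv_G q : map_mx deriv (G q) =
  QP q + \sum_(t < (q + b).+1) cst (A q t) *: G t - G q *m PP
  - \sum_(u < b) (G q *m PQ u) *m G u.
Proof.
apply/matrixP => i0 i; rewrite mxE [G q i0 i]mxE; apply: fpsP => m.
rewrite [LHS]/= riccatiS /riccati_step -[LHS]mulr_natr divfK ?pnatr_eq0 //.
rewrite !subr_mxE [(QP q + _) i0 i]mxE !fcoefB fcoefD.
congr (_ + _ - _ - _).
- by rewrite mxE; case: m.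
- by rewrite summxE fcoef_sum; apply: eq_bigr => t _; rewrite !mxE fcoef_constM.
(* The cutoffs at [i + b] and at [N] keep the same nonzero terms: past the first the band kills
   them, past the second [Arow0] does. *)
- rewrite mxE fcoef_sum.
  rewrite (@sum_ord_cutoff _ (fun t => riccati A b m q t * A (Negz t) (Negz i))
    _ N) => [|t]; last first.
    rewrite geq_min => /orP[|] ht; last by rewrite Arow0 ?mulr0.
    by rewrite Aband ?mulr0 //; lia.
  by apply: eq_bigr => t _; rewrite !mxE fcoef_Mconst.
rewrite summxE fcoef_sum exchange_big /=.
under eq_bigr do rewrite exchange_big /=.
rewrite exchange_big /=; apply: eq_bigr => u _.
rewrite !mxE big_ord1 !mxE fcoefM exchange_big /=; apply: eq_bigr => k _.
rewrite fcoef_sum mulr_suml.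
rewrite (@sum_ord_cutoff _ (fun t => riccati A b k q t * A (Negz t) u *
   riccati A b (m - k) u i) _ N) => [|t]; last first.
  rewrite geq_min => /orP[|] ht; last by rewrite Arow0 ?mulr0 ?mul0r.
  by rewrite Aband ?mulr0 ?mul0r //; lia.
by apply: eq_bigr => t _; rewrite !mxE fcoef_Mconst.
Qed.

(* W solves a homogeneous linear differential system with W(0) = 0. *)
Let W q := Y q - G q *m X.

(** In Y' - G' X - G X' the contributions of QAP and PAP cancel; what is left is QAQ W - G PAQ W. *)
Lemma deriv_W q : map_mx deriv (W q) =
  \sum_(t < (q + b).+1) cst (A q t) *: W t
  - \sum_(u < b) (G q *m PQ u) *m W u.
Proof.
have sumW : \sum_(t < (q + b).+1) cst (A q t) *: W t =
    \sum_(t < (q + b).+1) cst (A q t) *: Y t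
    - (\sum_(t < (q + b).+1) cst (A q t) *: G t) *m X.
  rewrite mulmx_suml -sumrB; apply: eq_bigr => t _.
  by rewrite scalerBr scalemxAl.
have sumPW : \sum_(u < b) (G q *m PQ u) *m W u =
    G q *m (\sum_(u < b) PQ u *m Y u)
    - (\sum_(u < b) (G q *m PQ u) *m G u) *m X.
  rewrite mulmx_suml mulmx_sumr -sumrB; apply: eq_bigr => t _.
  rewrite mulmxBr; congr (_ - _); first by rewrite -mulmxA.
  by rewrite mulmxA.
rewrite {}sumW {}sumPW /W raddfB /= (derivation_mulmx (@fps_derivM K)).
rewrite deriv_Y deriv_G deriv_X !mulmxBl !mulmxDl mulmxDr mulmxA.
move: (QP q *m X) (\sum_(t < (q + b).+1) _) ((\sum_(t < (q + b).+1) _) *m X)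
  (G q *m PP *m X) ((\sum_(u < b) _) *m X) (G q *m \sum_(u < b) _).
by move=> M1 M2 M3 M4 M5 M6; apply/matrixP => i j; rewrite !mxE; ring.
Qed.

(** The system expresses coefficient m + 1 through coefficients up to m of other rows, so the
    induction runs over all [q] at once. *)
Lemma coef_W0 m q j k : (k <= m)%N -> fcoef (W q 0 j) k = 0.
Proof.
elim: m q j k => [|m IH] q j k.
  rewrite leqn0 => /eqP ->; rewrite !mxE fcoefB fcoef_sum big1 => [|t _].
    by rewrite /= E0 mul0r subr0.
  by rewrite !mxE fcoefM0 /= mul0r.
rewrite leq_eqVlt => /orP[/eqP ->|]; last by rewrite ltnS; exact: IH.
have := congr1 (fun M : 'rV_N => fcoef (M 0 j) m) (deriv_W q).
rewrite mxE => dW.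
have : fcoef (W q 0 j) m.+1 *+ m.+1 = 0.
  rewrite -[LHS]/(fcoef (fps_deriv (W q 0 j)) m) dW subr_mxE fcoefB !summxE !fcoef_sum.
  rewrite !big1 ?subr0 // => t _; rewrite mxE.
    by rewrite big_ord1 fcoefM_eq0 // => k' km; exact: IH.
  by rewrite fcoefM_eq0 // => k' km; exact: IH.
by move/eqP; rewrite -mulr_natr mulf_eq0 pnatr_eq0 orbF => /eqP.
Qed.

Lemma exp_factor q : Y q = G q *m X.
Proof.
apply/eqP; rewrite -subr_eq0; apply/eqP/matrixP => i j; rewrite ord1 [RHS]mxE.
by apply: fpsP => k; rewrite (coef_W0 _ _ (leqnn k)) fcoef0.
Qed.

Lemma deriv_X_factor :
  map_mx deriv X = (PP + \sum_(u < b) PQ u *m G u) *m X.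
Proof.
rewrite deriv_X mulmxDl mulmx_suml; congr (_ + _); apply: eq_bigr => u _.
by rewrite exp_factor mulmxA.
Qed.

Let tau := \sum_(i < N) A (Negz i) (Negz i).

Definition fps_exp (x : K) : fps K := Fps (fun k => x ^+ k / k`!%:R).

Lemma deriv_fps_exp x : deriv (fps_exp x) = cst x * fps_exp x.
Proof.
apply: fpsP => k; rewrite fcoef_constM /= factS -mulrnAr exprS -mulrA.
by rewrite natrM invfM -[in LHS]mulr_natl [_%:R * (_ * _)]mulrA divff ?pnatr_eq0 // mul1r.
Qed.

Lemma trace_factor : \tr (PP + \sum_(u < b) PQ u *m G u) =
  cst tau + Fps (trace_coef A b).
Proof.
rewrite raddfD raddf_sum /=; congr (_ + _).
  by rewrite /mxtrace fps_const_sum; apply: eq_bigr => i _; rewrite mxE.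
apply: fpsP => m; rewrite fcoef_sum /= /trace_coef exchange_big /=.
apply: eq_bigr => u _; rewrite fcoef_sum.
rewrite (@sum_ord_cutoff _ (fun t => A (Negz t) u * riccati A b m u t) _ N).
  by apply: eq_bigr => t _; rewrite mxE big_ord1 !mxE fcoef_constM.
move=> t; rewrite geq_min => /orP[|] ht; last by rewrite Arow0 ?mul0r.
by rewrite Aband ?mul0r //; lia.
Qed.

(** The prefactor contributes -[tau] to the logarithmic derivative and cancels the trace of [PP]; F
    then satisfies the same first-order recursion as [det_coef]. *)
Lemma det_coefE :
  fps_exp (- \sum_(i < N) A (Negz i) (Negz i)) *
  \det (\matrix_(i < N, j < N) fps_exp_entry (Negz i) (Negz j)) =
  Fps (det_coef A b).
Proof.
rewrite -/tau -/X; set F := _ * _.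
(* Since [X] factors out of its own derivative on the right, [X *m \adj X] collapses to the scalar
   det X without any inverse. *)
have dF : deriv F = Fps (trace_coef A b) * F.
  rewrite /F fps_derivM deriv_fps_exp (derivation_det (@fps_derivM K)).
  rewrite deriv_X_factor -mulmxA mul_mx_adj mul_mx_scalar mxtraceZ.
  by rewrite trace_factor fps_constN; ring.
have F0 : fcoef F 0 = 1.
  rewrite fcoefM0 /= expr0 mul1r invr1 mul1r -[LHS]/(fps_head (\det X)).
  rewrite -det_map_mx -[RHS](det1 _ N); congr (\det _).
  apply/matrixP => i j; rewrite !mxE /= /fps_head /= E0 divr1.
  by rewrite -[Negz i == Negz j]/(i == j :> nat).
suff H m k : (k <= m)%N -> fcoef F k = det_coef A b k.
  by apply: fpsP => k; exact: (H k).
elim: m k => [|m IH] k; first by rewrite leqn0 => /eqP ->.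
rewrite leq_eqVlt => /orP[/eqP ->|]; last by rewrite ltnS; exact: IH.
rewrite det_coefS /det_coef_step; apply/esym/(canLR (mulfVK _)).
  by rewrite invr_eq0 pnatr_eq0.
rewrite invrK mulr_natr -[RHS]/(fcoef (deriv F) m) dF fcoefM.
by apply: eq_bigr => t _; rewrite IH ?leq_subr.
Qed.

End CompressedExponential.

(** * Geometric bounds and entrywise continuity of the coefficients *)

Section CoefficientBounds.
Variable K : numFieldType.
Implicit Types (A : int -> int -> K) (b : nat).

Lemma count_window (n r b : nat) :
  (\sum_(t < n) ((r <= t + b) && (t <= r + b)) <= (2 * b).+1)%N.
Proof.
pose P := [pred t | (r <= t + b) && (t <= r + b)]%N.
rewrite -(big_mkord xpredT (fun t => nat_of_bool (P t))).
have -> : \sum_(0 <= t < n) nat_of_bool (P t) = count P (iota 0 n).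
  rewrite -sum1_count /index_iota subn0 [RHS]big_mkcond.
  by apply: eq_bigr => t _; case: (P t).
rewrite -size_filter -[leqRHS](size_iota (r - b)); apply: uniq_leq_size.
  by rewrite filter_uniq ?iota_uniq.
by move=> t; rewrite mem_filter !mem_iota /= => H; lia.
Qed.

Lemma norm_window_sum (F : nat -> K) (n r b : nat) (M : K) : 0 <= M ->
  (forall t, (r <= t + b)%N -> (t <= r + b)%N -> `|F t| <= M) ->
  (forall t, (t + b < r)%N || (r + b < t)%N -> F t = 0) ->
  `|\sum_(t < n) F t| <= (2 * b).+1%:R * M.
Proof.
move=> M0 FM F0; apply: le_trans (ler_norm_sum _ _ _) _.
apply: le_trans (_ : \sum_(t < n) ((r <= t + b) && (t <= r + b))%N%:R * M <= _).
  apply: ler_sum => t _; case: andP => [[rt tr]|/andP]; first by rewrite mul1r FM.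
  by rewrite negb_and -!ltnNge => H; rewrite F0 // normr0 mul0r.
by rewrite -mulr_suml -natr_sum ler_wpM2r // ler_nat count_window.
Qed.

(* Majorant of the Riccati recursion: (2b+1)^2 beta bounds every row, column
   and block sum of absolute values in it, and its right-hand side has four terms. *)
Definition coef_ratio b (beta : K) : K := 4 * ((2 * b).+1%:R ^+ 2 * beta).

Section Bounds.
Variables (A : int -> int -> K) (b : nat) (beta : K).
Hypothesis Aband : banded_int A b.
Hypothesis A_le : forall r s, `|A r s| <= beta.
Hypothesis beta_ge1 : 1 <= beta.

Local Notation kappa := ((2 * b).+1%:R ^+ 2 * beta).
Local Notation D := (coef_ratio b beta).

Let beta_ge0 : 0 <= beta. Proof. exact: le_trans beta_ge1. Qed.
Let window_ge1 : 1 <= (2 * b).+1%:R :> K. Proof. by rewrite ler1n. Qed.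
Let window_ge0 : 0 <= (2 * b).+1%:R :> K. Proof. exact: ler0n. Qed.
Let window_le : (2 * b).+1%:R * beta <= kappa.
Proof. by rewrite ler_wpM2r // expr2 ler_peMr. Qed.
Let beta_le : beta <= kappa.
Proof. by apply: le_trans window_le; rewrite ler_peMl. Qed.
Let kappa_ge1 : 1 <= kappa. Proof. exact: le_trans beta_le. Qed.
Let D_ge1 : 1 <= D.
Proof. by apply: mulr_ege1; rewrite ?ler1n ?kappa_ge1. Qed.
Let DX_ge0 m : 0 <= D ^+ m.
Proof. by rewrite exprn_ge0 // (le_trans ler01). Qed.
Let D_ge_kappa : kappa <= D.
Proof. by rewrite ler_peMl ?(le_trans ler01) // ler1n. Qed.

Let square_sum_le (F : 'I_b -> 'I_b -> K) (M : K) : 0 <= M ->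
  (forall t u, `|F t u| <= beta * M) ->
  `|\sum_(t < b) \sum_(u < b) F t u| <= kappa * M.
Proof.
move=> M0 FM; apply: le_trans (_ : \sum_(t < b) \sum_(u < b) beta * M <= _).
  apply: le_trans (ler_norm_sum _ _ _) _; apply: ler_sum => t _.
  by apply: le_trans (ler_norm_sum _ _ _) _; apply: ler_sum => u _.
rewrite !sumr_const !card_ord -mulrnA -[_ *+ (b * b)]mulr_natl mulrA ler_wpM2r //.
by rewrite ler_wpM2r // -natrX ler_nat; lia.
Qed.

Lemma riccati_le m q i : `|riccati A b m q i| <= D ^+ m.
Proof.
elim/ltn_ind: m q i => -[|m] IH q i; first by rewrite normr0 ler01.
have IHm k q' i' : (k <= m)%N -> `|riccati A b k q' i'| <= D ^+ k.
  by move=> km; apply: IH.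
rewrite riccatiS /riccati_step normrM normfV normr_nat ler_pdivrMr ?ltr0n //.
(* The bound is split among the four terms of the recursion. The quadratic one is a convolution of m
   + 1 products, each at most kappa D^m, and the denominator m + 1 pays for their number; this keeps
   the growth geometric. *)
have -> : D ^+ m.+1 * m.+1%:R = kappa * D ^+ m * m.+1%:R
    + kappa * D ^+ m * m.+1%:R + kappa * D ^+ m * m.+1%:R
    + \sum_(k < m.+1) kappa * D ^+ m.
  by rewrite sumr_const card_ord -[_ *+ m.+1]mulr_natr exprS /coef_ratio; ring.
have le_m (x : K) : 0 <= x -> x <= x * m.+1%:R by move=> x0; rewrite ler_peMr // ler1n.
have kD0 : 0 <= kappa * D ^+ m by rewrite mulr_ge0 // (le_trans ler01).
apply: le_trans (ler_normB _ _) _; apply: lerD; last first.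
  apply: le_trans (ler_norm_sum _ _ _) _; apply: ler_sum => k _.
  have km : (k <= m)%N by rewrite -ltnS.
  apply: square_sum_le => // t u; rewrite !normrM [X in X * _]mulrC -mulrA.
  apply: ler_pM; rewrite ?mulr_ge0 //.
  rewrite -[X in _ ^+ X](subnKC km) exprD; apply: ler_pM => //; first exact: IHm.
  by apply: IHm; rewrite leq_subr.
apply: le_trans (ler_normB _ _) _; apply: lerD; last first.
  apply: le_trans (le_m _ kD0); apply: le_trans (_ : (2 * b).+1%:R * (beta * D ^+ m) <= _).
    apply: (@norm_window_sum (fun t => riccati A b m q t * A (Negz t) (Negz i)) _ i).
    - by rewrite mulr_ge0.
    - by move=> t _ _; rewrite normrM mulrC ler_pM // IHm.
    by move=> t ht; rewrite Aband ?mulr0 //; lia.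
  by rewrite mulrA ler_wpM2r.
apply: le_trans (ler_normD _ _) _; apply: lerD.
  apply: le_trans (le_m _ kD0); apply: le_trans (_ : beta <= _).
    by case: (m) => //; rewrite normr0.
  by rewrite (le_trans beta_le) // ler_peMr ?exprn_ege1 // (le_trans ler01).
apply: le_trans (le_m _ kD0); apply: le_trans (_ : (2 * b).+1%:R * (beta * D ^+ m) <= _).
  apply: (@norm_window_sum (fun t => A q t * riccati A b m t i) _ q).
  - by rewrite mulr_ge0.
  - by move=> t _ _; rewrite normrM ler_pM // IHm.
  by move=> t ht; rewrite Aband ?mul0r //; lia.
by rewrite mulrA ler_wpM2r.
Qed.

Lemma det_coef_le m : `|det_coef A b m| <= D ^+ m.
Proof.
elim/ltn_ind: m => -[|m] IH; first by rewrite /det_coef /= normr1.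
rewrite det_coefS /det_coef_step normrM normfV normr_nat ler_pdivrMr ?ltr0n //.
apply: le_trans (ler_norm_sum _ _ _) _.
have -> : D ^+ m.+1 * m.+1%:R = \sum_(k < m.+1) D ^+ m.+1.
  by rewrite sumr_const card_ord mulr_natr.
apply: ler_sum => k _.
have km : (k <= m)%N by rewrite -ltnS.
rewrite normrM exprS -[X in D * _ ^+ X](subnKC km) exprD mulrA.
apply: ler_pM => //; last by apply: IH; rewrite ltnS leq_subr.
apply: le_trans (_ : kappa * D ^+ k <= _); last by rewrite ler_wpM2r.
by apply: square_sum_le => // t u; rewrite normrM ler_pM // riccati_le.
Qed.

End Bounds.

Section Continuity.
Variables (An : nat -> int -> int -> K) (A : int -> int -> K) (b : nat).
Hypothesis AnA : forall r s, (fun n => An n r s) @ \oo --> A r s.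

Lemma riccati_cvg m q i :
  (fun n => riccati (An n) b m q i) @ \oo --> riccati A b m q i.
Proof.
elim/ltn_ind: m q i => -[|m] IH q i; first exact: cvg_cst.
have IHm k q' i' : (k <= m)%N ->
  (fun n => riccati (An n) b k q' i') @ \oo --> riccati A b k q' i'.
  by move=> km; apply: IH.
rewrite riccatiS; under eq_fun do rewrite riccatiS.
rewrite /riccati_step; apply: cvgM; last exact: cvg_cst.
apply: cvgB; first apply: cvgB; first apply: cvgD.
- by case: (m); [exact: AnA | move=> _; exact: cvg_cst].
- by apply: cvgn_sum => t; apply: cvgM; [exact: AnA | exact: IHm].
- by apply: cvgn_sum => t; apply: cvgM; [exact: IHm | exact: AnA].
apply: cvgn_sum => k; apply: cvgn_sum => t; apply: cvgn_sum => u.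
apply: cvgM; first apply: cvgM.
- by apply: IHm; rewrite -ltnS.
- exact: AnA.
- by apply: IHm; rewrite leq_subr.
Qed.

Lemma det_coef_cvg m : (fun n => det_coef (An n) b m) @ \oo --> det_coef A b m.
Proof.
elim/ltn_ind: m => -[|m] IH; first exact: cvg_cst.
rewrite det_coefS; under eq_fun do rewrite det_coefS.
rewrite /det_coef_step; apply: cvgM; last exact: cvg_cst.
apply: cvgn_sum => k; apply: cvgM; last by apply: IH; rewrite ltnS leq_subr.
apply: cvgn_sum => t; apply: cvgn_sum => u.
by apply: cvgM; [exact: AnA | exact: riccati_cvg].
Qed.

End Continuity.

End CoefficientBounds.

(** * Limits and re-expansion of power series *)

Section PowerSeriesLimit.
Variable K : numFieldType.
Hypothesis half_small : forall e : K, 0 < e -> exists n, (2^-1 : K) ^+ n < e.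

Let half_ge0 k : 0 <= (2^-1 : K) ^+ k.
Proof. by rewrite exprn_ge0 // invr_ge0 ler0n. Qed.

Lemma psum_unif_cvg (a : nat -> fps K) (a0 : fps K) (Z : set K)
    (F : nat -> K -> K) (L : K -> K) :
  (forall m, (fun j => fcoef (a j) m) @ \oo --> fcoef a0 m) ->
  (forall z, Z z -> `|z| <= 1) ->
  (forall z j k, Z z -> `|psum (a j) z k - F j z| <= 2 * 2^-1 ^+ k) ->
  (forall z k, Z z -> `|psum a0 z k - L z| <= 2 * 2^-1 ^+ k) ->
  forall e, 0 < e -> exists J, forall j, (J <= j)%N ->
    forall z, Z z -> `|F j z - L z| < e.
Proof.
move=> acvg Z1 aF aL e e0.
(* With [e / 8] each of the two tails is below [e / 4], leaving [e / 2] for the finitely many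
   coefficients, whose effect is uniform because |z| <= 1. *)
have [k ke] := half_small (divr_gt0 e0 (ltr0n _ 8 : 0 < 8 :> K)).
have : (fun j => \sum_(m < k) `|fcoef (a j) m - fcoef a0 m|) @ \oo -->
    \sum_(m < k) (0 : K).
  apply: cvgn_sum => m; apply/cvgnP => e' e'0.
  have /cvgnP/(_ _ e'0)[J aJ] := acvg m; exists J => j /aJ.
  by rewrite subr0 normr_id.
rewrite big1 // => /cvgnP/(_ _ (divr_gt0 e0 (ltr0n _ 2 : 0 < 2 :> K)))[J aJ].
exists J => j /aJ; rewrite subr0 => sum_lt z Zz.
have -> : F j z - L z = (F j z - psum (a j) z k) +
    ((psum (a j) z k - psum a0 z k) + (psum a0 z k - L z)) by ring.
apply: le_lt_trans (ler_normD _ _) _.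
apply: le_lt_trans (lerD (lexx _) (ler_normD _ _)) _; rewrite distrC.
have psum_le : `|psum (a j) z k - psum a0 z k| <=
    `|\sum_(m < k) `|fcoef (a j) m - fcoef a0 m| |.
  rewrite [leRHS]ger0_norm ?sumr_ge0 // /psum -sumrB.
  apply: le_trans (ler_norm_sum _ _ _) _; apply: ler_sum => m _.
  by rewrite -mulrBl normrM ler_piMr // normrX exprn_ile1 ?Z1.
apply: le_lt_trans (lerD (aF z j k Zz) (lerD psum_le (aL z k Zz))) _.
have : 2 * 2^-1 ^+ k < e / 4 :> K.
  have -> : e / 4 = 2 * (e / 8) by field.
  by rewrite ltr_pM2l ?ltr0n.
move=> lt1; have -> : e = e / 4 + (e / 2 + e / 4) by field.
by rewrite ltrD // ltrD.
Qed.

Lemma psum_shift (a : fps K) (z h : K) (n : nat) :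
  psum a (z + h) n = \sum_(k < n)
    (\sum_(m < n) fcoef a m * z ^+ (m - k) *+ 'C(m, k)) * h ^+ k.
Proof.
under [RHS]eq_bigr do rewrite mulr_suml.
rewrite exchange_big /=; apply: eq_bigr => m _; rewrite exprDn mulr_sumr.
rewrite (@sum_ord_cutoff _ (fun k => fcoef a m * (z ^+ (m - k) * h ^+ k *+ 'C(m, k)))
  _ n) => [|k].
  by apply: eq_bigr => k _; rewrite mulrnAr mulrnAl mulrA.
by rewrite (minn_idPl _) // => mk; rewrite bin_small ?mulr0n ?mulr0.
Qed.

(** The binomial term, multiplied by t^k, is one summand of (|z| + t)^m. The resulting 4^-m is kept
    as two factors 2^-m: one sums the series over m, the other is reserved for the sum over k. *)
Lemma shift_coef_le (a : fps K) (D z t : K) (m k : nat) : 0 < D -> 0 < t ->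
  `|fcoef a m| <= D ^+ m -> (`|z| + t) * D <= 4^-1 ->
  `|fcoef a m * z ^+ (m - k) *+ 'C(m, k)| <= t ^- k * 2^-1 ^+ m * 2^-1 ^+ m.
Proof.
move=> D0 t0 am ztD; rewrite -mulrA -exprMn -invfM -natrM.
have zt0 : 0 <= `|z| + t by rewrite addr_ge0 // ltW.
have bin_le : `|z| ^+ (m - k) * t ^+ k *+ 'C(m, k) <= (`|z| + t) ^+ m.
  have [km|mk] := leqP k m; last by rewrite bin_small // mulr0n exprn_ge0.
  have km1 : (k < m.+1)%N by [].
  rewrite exprDn (bigD1 (Ordinal km1)) //= lerDl sumr_ge0 // => i _.
  by rewrite mulrn_wge0 // mulr_ge0 ?exprn_ge0 // ltW.
rewrite ler_pdivlMl ?exprn_gt0 // normrMn normrM normrX mulrnAr mulrCA.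
rewrite -mulrnAr.
apply: le_trans (_ : D ^+ m * (`|z| + t) ^+ m <= _).
  apply: ler_pM => //; first by rewrite mulrn_wge0 // mulr_ge0 ?exprn_ge0 // ltW.
  by rewrite mulrC.
rewrite -exprMn mulrC; apply: lerXn2r ztD; rewrite nnegrE.
  by rewrite mulr_ge0 // ltW.
by rewrite invr_ge0 ler0n.
Qed.

Lemma psum_shift_cvg (a A : fps K) (D z t h v : K) : 0 < D -> 0 < t ->
  (forall m, `|fcoef a m| <= D ^+ m) -> (`|z| + t) * D <= 4^-1 -> `|h| <= t ->
  (forall k, (fun n => \sum_(m < n) fcoef a m * z ^+ (m - k) *+ 'C(m, k)) @ \oo
     --> fcoef A k) ->
  psum a (z + h) @ \oo --> v -> psum A h @ \oo --> v.
Proof.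
move=> D0 t0 aD ztD ht Acvg av; rewrite -[v]add0r.
pose diff n := psum A h n - psum a (z + h) n.
suff diff0 : diff @ \oo --> (0 : K).
  apply: (cvgn_eq_near (N := 0%N) _ (cvgD diff0 av)) => n _.
  by rewrite -[RHS]/(_ - _ + _) subrK.
apply: (@cvgn_half_bound _ half_small _ _ 2) => n; rewrite subr0 /diff.
rewrite psum_shift /psum -sumrB.
(* The tail m >= n of the new coefficient. Below, t^-k is compensated by |h|^k, and one factor 2^-n
   outweighs the n coefficients being added. *)
have coef_diff k : `|fcoef A k - \sum_(m < n) fcoef a m * z ^+ (m - k) *+ 'C(m, k)|
    <= t ^- k * (2 * 2^-1 ^+ n * 2^-1 ^+ n).
  rewrite distrC; apply: (cvgn_dist_le (Acvg k)) => p np.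
  rewrite -!(big_mkord xpredT (fun m => fcoef a m * z ^+ (m - k) *+ 'C(m, k))).
  rewrite (big_cat_nat _ np) //= addrAC subrr add0r.
  apply: le_trans (ler_norm_sum _ _ _) _.
  apply: le_trans (_ : \sum_(n <= m < p) t ^- k * 2^-1 ^+ n * 2^-1 ^+ m <= _).
    apply: ler_sum_nat => m /andP[nm _].
    apply: le_trans (shift_coef_le k D0 t0 (aD m) ztD) _.
    rewrite ler_wpM2r // ler_wpM2l ?invr_ge0 ?exprn_ge0 ?(ltW t0) //.
    by rewrite ler_wiXn2l ?invr_ge0 ?ler0n // invf_le1 ?ltr0n ?ler1n.
  rewrite -mulr_sumr -[leLHS]mulrA ler_wpM2l ?invr_ge0 ?exprn_ge0 ?(ltW t0) //.
  by rewrite [leRHS]mulrC ler_wpM2l // half_sum_le.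
apply: le_trans (ler_norm_sum _ _ _) _.
apply: le_trans (_ : \sum_(k < n) 2 * 2^-1 ^+ n * 2^-1 ^+ n <= _).
  apply: ler_sum => k _; rewrite -mulrBl normrM normrX.
  apply: le_trans (ler_wpM2r (exprn_ge0 _ (normr_ge0 h)) (coef_diff k)) _.
  rewrite mulrAC ler_piMl ?mulr_ge0 ?ler0n // mulrC ler_pdivrMr ?exprn_gt0 //.
  by rewrite mul1r lerXn2r ?nnegrE // ltW.
rewrite sumr_const card_ord -mulrnAr ler_piMr ?mulr_ge0 ?ler0n //.
rewrite -mulr_natl exprVn ler_pdivrMr ?exprn_gt0 ?ltr0n //.
by rewrite mul1r -natrX ler_nat ltnW // ltn_expl.
Qed.

End PowerSeriesLimit.

(** * From formal series to values of determinants *)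

Section Evaluation.
Variable R : realType.
Local Notation C := (Cpx R).

Lemma nat_ge (e : C) : 0 <= e -> exists n, e <= n%:R.
Proof.
rewrite le_eqVlt => /orP[/eqP <-|e0]; first by exists 0%N.
have [n nlt] := @half_pow_lt R e^-1 (eq_ind_r is_true e0 (invr_gt0 e)).
exists (2 ^ n)%N; rewrite natrX ltW //.
by rewrite -ltf_pV2 ?posrE ?exprn_gt0 ?ltr0n // -exprVn.
Qed.

Lemma entire_evalto (a : fps C) z : entire a -> exists v, evalto a z v.
Proof.
move=> ea; have x0 : 0 < 2 * (`|z| + 1) by rewrite mulr_gt0 ?ltr0n ?ltr_wpDl.
have [M aM] := ea _ x0.
have [|v [av _]] := @geo_cvg R (fun k => fcoef a k * z ^+ k) M; last by exists v.
move=> k; rewrite exprVn ler_pdivlMr ?exprn_gt0 ?ltr0n //.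
apply: le_trans (aM k); rewrite normrM normrX -mulrA ler_wpM2l //.
rewrite exprMn mulrC ler_wpM2l ?exprn_ge0 ?ler0n //.
by apply: lerXn2r; rewrite ?nnegrE ?addr_ge0 ?ler01 // lerDl ler01.
Qed.

Lemma entire_fps_exp (x : C) : entire (fps_exp x).
Proof.
apply: (@entire_exp_bound _ _ `|x|) => //; first exact: nat_ge.
by move=> k; rewrite normrM normrX normfV normr_nat.
Qed.

Lemma evalto_fps_exp (x z : C) : evalto (fps_exp x) z (cexp (z * x)).
Proof.
have [v [ev xv]] := entire_evalto z (entire_fps_exp x).
suff -> : cexp (z * x) = v by [].
apply: cvgn_lim; apply: (cvgn_eq_near (N := 0%N) _ xv) => n _.
by apply: eq_bigr => k _; rewrite exprMn mulrC mulrA mulrAC [_ * x ^+ _]mulrC.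
Qed.

Section Det.
Variables (A : int -> int -> C) (b N : nat) (E : nat -> int -> int -> C).
Variable beta : C.
Hypothesis Aband : banded_int A b.
Hypothesis Arow0 : forall i s, (N <= i)%N -> A (Negz i) s = 0.
Hypothesis A_le : forall r s, `|A r s| <= beta.
Hypothesis beta_ge1 : 1 <= beta.
Hypothesis E0 : forall r s, E 0 r s = (r == s)%:R.
Hypothesis ES_neg : forall k (i j : 'I_N), E k.+1 (Negz i) (Negz j) =
  \sum_(t < N) A (Negz i) (Negz t) * E k (Negz t) (Negz j)
  + \sum_(u < b) A (Negz i) u * E k u (Negz j).
Hypothesis ES_pos : forall k (q : nat) (j : 'I_N), E k.+1 q (Negz j) =
  \sum_(t < N) A q (Negz t) * E k (Negz t) (Negz j)
  + \sum_(u < (q + b).+1) A q u * E k u (Negz j).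

(** A crude bound whose base depends on [N]: it serves only to make the entries entire at fixed
    size. The rows on both sides of the cut are bounded together because the recursion mixes
    them. *)
Lemma power_le k (j : 'I_N) :
  (forall i : 'I_N, `|E k (Negz i) (Negz j)| <= ((N + (2 * b).+1)%:R * beta) ^+ k) /\
  (forall q : nat, `|E k q (Negz j)| <= ((N + (2 * b).+1)%:R * beta) ^+ k).
Proof.
set c : C := _ * beta; have beta0 : 0 <= beta by exact: le_trans beta_ge1.
have c0 : 0 <= c by rewrite mulr_ge0 ?ler0n.
elim: k => [|k [IHneg IHpos]].
  by split=> r; rewrite E0; case: eqP; rewrite ?normr1 ?normr0 ?ler01.
have ck0 : 0 <= beta * c ^+ k by rewrite mulr_ge0 ?exprn_ge0.
have cS : c ^+ k.+1 = N%:R * (beta * c ^+ k) + (2 * b).+1%:R * (beta * c ^+ k).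
  by rewrite exprS {1}/c natrD; ring.
have negsum r : `|\sum_(t < N) A r (Negz t) * E k (Negz t) (Negz j)| <=
    N%:R * (beta * c ^+ k).
  have -> : N%:R * (beta * c ^+ k) = \sum_(t < N) beta * c ^+ k.
    by rewrite sumr_const card_ord mulr_natl.
  apply: le_trans (ler_norm_sum _ _ _) _; apply: ler_sum => t _.
  by rewrite normrM ler_pM.
split=> [i|q]; rewrite ?ES_neg ?ES_pos cS; apply: le_trans (ler_normD _ _) _.
  apply: lerD => //; apply: le_trans (_ : \sum_(u < b) beta * c ^+ k <= _).
    apply: le_trans (ler_norm_sum _ _ _) _; apply: ler_sum => u _.
    by rewrite normrM ler_pM.
  by rewrite sumr_const card_ord -[_ *+ b]mulr_natl ler_wpM2r // ler_nat; lia.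
apply: lerD => //; apply: (@norm_window_sum _ (fun u => A q u * E k u (Negz j)) _ q).
- by [].
- by move=> u _ _; rewrite normrM ler_pM.
by move=> u ht; rewrite Aband ?mul0r //; lia.
Qed.

Lemma entire_fps_exp_entry (i j : 'I_N) :
  entire (fps_exp_entry E (Negz i) (Negz j)).
Proof.
have c0 : 0 <= (N + (2 * b).+1)%:R * beta.
  by rewrite mulr_ge0 ?ler0n // (le_trans ler01).
apply: (@entire_exp_bound _ _ ((N + (2 * b).+1)%:R * beta)) => //.
  exact: nat_ge.
move=> k /=; rewrite normrM normfV normr_nat.
by rewrite ler_wpM2r ?invr_ge0 ?ler0n //; case: (power_le k j).
Qed.

(** Evaluates both sides of [det_coefE]. The prefactor and the matrix entries are entire, so no
    restriction on z appears. *)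
Lemma det_coef_psum_cvg z : psum (Fps (det_coef A b)) z @ \oo -->
  cexp (- z * \sum_(i < N) A (Negz i) (Negz i)) *
  \det (\matrix_(i < N, j < N) limn (fun K =>
    \sum_(k < K) z ^+ k / k`!%:R * E k (Negz i) (Negz j))).
Proof.
rewrite -(det_coefE Aband Arow0 E0 ES_neg ES_pos) mulNr -mulrN.
apply: (proj2 (evaltoM (@half_pow_lt R) (evalto_fps_exp _ _) _)).
apply: (evalto_det (@half_pow_lt R)) => i j; rewrite !mxE.
have [v [ev xv]] := entire_evalto z (entire_fps_exp_entry i j).
suff -> : limn (fun K => \sum_(k < K) z ^+ k / k`!%:R * E k (Negz i) (Negz j)) = v.
  by [].
apply: cvgn_lim; apply: (cvgn_eq_near (N := 0%N) _ xv) => n _.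
by apply: eq_bigr => k _; rewrite mulrC mulrA mulrAC.
Qed.

End Det.

End Evaluation.

Lemma det_perm_conj (K : comNzRingType) (n : nat) (s : 'S_n) (M : 'M[K]_n) :
  \det (\matrix_(i < n, j < n) M (s i) (s j)) = \det M.
Proof.
have -> : \matrix_(i < n, j < n) M (s i) (s j) = row_perm s (col_perm s M).
  by apply/matrixP => i j; rewrite !mxE.
rewrite row_permE col_permE !det_mulmx !det_perm mulrCA mulrA odd_permV.
by rewrite -mulrA -signr_addb addbb mulr1.
Qed.

(** Chosen so that radius times D is 1/4: summation alone would accept 1/2, but re-expansion at
    another centre uses the decay 4^-m. *)
Definition cvg_radius (K : numFieldType) (b : nat) (beta : K) : K :=
  (4 * coef_ratio b beta)^-1.

(** * Analyticity and uniform convergence on the common disc *)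

Section Limits.
Variable R : realType.
Local Notation C := (Cpx R).
Variables (b : nat) (beta : C).
Hypothesis beta_ge1 : 1 <= beta.

Local Notation D := (coef_ratio b beta).
Local Notation eps := (cvg_radius b beta).

Let D_gt0 : 0 < D.
Proof.
by rewrite !mulr_gt0 ?ltr0n ?exprn_gt0 ?ltr0n // (lt_le_trans ltr01).
Qed.

Let D_ge1 : 1 <= D.
Proof.
apply: mulr_ege1; first by rewrite ler1n.
by apply: mulr_ege1 => //; rewrite exprn_ege1 ?ler1n.
Qed.

Lemma cvg_radius_gt0 : 0 < eps.
Proof. by rewrite invr_gt0 mulr_gt0 ?ltr0n. Qed.

Let eps_le1 : eps <= 1.
Proof.
rewrite invf_le1; last by rewrite mulr_gt0 ?ltr0n.
by apply: mulr_ege1; rewrite ?ler1n.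
Qed.

Let epsD : eps * D = 4^-1.
Proof. by rewrite /cvg_radius invfM mulfVK // gt_eqF. Qed.

Lemma psum_geo_cvg (a : fps C) (z : C) :
  (forall m, `|fcoef a m| <= D ^+ m) -> `|z| <= eps ->
  exists l : C, psum a z @ \oo --> l /\
    forall k, `|psum a z k - l| <= 2 * 2^-1 ^+ k.
Proof.
move=> aD ze.
have [m|l [al lk]] := @geo_cvg R (fun k => fcoef a k * z ^+ k) 1; last first.
  by exists l; split=> // k; rewrite -[X in X * _](mulr1 2); exact: lk.
rewrite mul1r normrM normrX; apply: le_trans (_ : D ^+ m * eps ^+ m <= _).
  by apply: ler_pM; rewrite ?exprn_ge0 //; apply: lerXn2r; rewrite ?nnegrE ?(ltW cvg_radius_gt0).
rewrite -exprMn mulrC epsD; apply: lerXn2r; rewrite ?nnegrE ?invr_ge0 ?ler0n //.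
by rewrite lef_pV2 ?posrE ?ltr0n // ler_nat.
Qed.

Lemma psum_limn (a : fps C) (z : C) :
  (forall m, `|fcoef a m| <= D ^+ m) -> `|z| <= eps ->
  psum a z @ \oo --> (limn (psum a z) : C) /\
  forall k, `|psum a z k - limn (psum a z)| <= 2 * 2^-1 ^+ k.
Proof.
move=> aD ze; have [l [al lk]] := psum_geo_cvg aD ze.
by rewrite (cvgn_lim al).
Qed.

(** With t = eps - |z0|, the largest disc about z0 inside the ball, (|z0| + t) D is exactly 1/4, as
    re-expansion requires. *)
Lemma analytic_psum (a : fps C) : (forall m, `|fcoef a m| <= D ^+ m) ->
  analytic_on (cball0 eps) (fun z => limn (psum a z)).
Proof.
move=> aD z0 z0e; have t0 : 0 < eps - `|z0| by rewrite subr_gt0.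
exists (eps - `|z0|); split=> //.
have ztD : (`|z0| + (eps - `|z0|)) * D <= 4^-1 by rewrite addrC subrK epsD.
have /choice[A Acvg] : forall k, exists l : C,
    (fun n => \sum_(m < n) fcoef a m * z0 ^+ (m - k) *+ 'C(m, k)) @ \oo --> l.
  move=> k.
  have [m|l [lk _]] := @geo_cvg R
    (fun m => fcoef a m * z0 ^+ (m - k) *+ 'C(m, k)) ((eps - `|z0|) ^- k).
    apply: le_trans (shift_coef_le k D_gt0 t0 (aD m) ztD) _.
    rewrite ler_piMr ?mulr_ge0 ?invr_ge0 ?exprn_ge0 ?invr_ge0 ?ler0n ?(ltW t0) //.
    by rewrite exprn_ile1 ?invr_ge0 ?ler0n // invf_le1 ?ltr0n // ler1n.
  by exists l.
exists A => z zt.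
have ze : `|z| <= eps.
  rewrite -[z](subrK z0); apply: le_trans (ler_normD _ _) _.
  by rewrite -lerBrDr ltW.
have [aL _] := psum_limn aD ze; rewrite -{1}[z](subrK z0) addrC in aL.
exact: (psum_shift_cvg (A := Fps A) (@half_pow_lt R) D_gt0 t0 aD ztD (ltW zt) Acvg aL).
Qed.

Lemma det_coef_unif_cvg (An : nat -> int -> int -> C) (A : int -> int -> C)
    (F : nat -> C -> C) :
  (forall j, banded_int (An j) b) -> (forall j r s, `|An j r s| <= beta) ->
  banded_int A b -> (forall r s, `|A r s| <= beta) ->
  (forall r s, (fun j => An j r s) @ \oo --> A r s) ->
  (forall j z, psum (Fps (det_coef (An j) b)) z @ \oo --> F j z) ->
  unif_cvg_on (cball0 eps) F (fun z => limn (psum (Fps (det_coef A b)) z)).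
Proof.
move=> Anb Anle Ab Ale AnA psumF.
have AnD j m : `|fcoef (Fps (det_coef (An j) b)) m| <= D ^+ m.
  exact: det_coef_le.
have AD m : `|fcoef (Fps (det_coef A b)) m| <= D ^+ m by exact: det_coef_le.
apply: (psum_unif_cvg (@half_pow_lt R)
  (a := fun j => Fps (det_coef (An j) b)) (a0 := Fps (det_coef A b))).
- by move=> m; exact: det_coef_cvg.
- by move=> z ze; rewrite (le_trans (ltW ze)).
- move=> z j k ze; have [_] := psum_limn (AnD j) (ltW ze).
  by rewrite (cvgn_lim (psumF j z)).
- by move=> z k ze; have [_] := psum_limn AD (ltW ze).
Qed.

End Limits.

(** * The two families of determinants *)

Section Links.
Variable R : realType.
Local Notation C := (Cpx R).

Lemma fdet1_nth (I : eqType) (K : I -> I -> C) (S : seq I) (x0 : I) (N : nat) :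
  size S = N -> fdet1 K S = \det (\matrix_(i < N, j < N)
    ((i == j)%:R + K (nth x0 S i) (nth x0 S j))).
Proof.
move=> <-; congr (\det _); apply/matrixP => i j.
by rewrite !mxE !(tnth_nth x0).
Qed.

(** Applying the operator bound to a basis vector and keeping a single row gives |B r s|^2 <= K. *)
Lemma bounded_nat_entries (B : nat -> nat -> C) : bounded_nat B ->
  exists2 beta : C, 1 <= beta & forall r s, `|B r s| <= beta.
Proof.
move=> [K BK].
have sqr_le r s : `|B r s| ^+ 2 <= K.
  have := BK r.+1 s.+1 (fun t => (t == s)%:R).
  rewrite big_ord_recr [X in _ <= _ * X]big_ord_recr /= eqxx normr1 expr1n.
  rewrite [X in _ <= _ * (X + _)]big1 => [|t _]; last first.
    by rewrite ltn_eqF // normr0 expr0n.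
  rewrite add0r mulr1; apply: le_trans.
  rewrite big_ord_recr /= eqxx mulr1 [X in X + B r s]big1 => [|t _].
    by rewrite add0r lerDr sumr_ge0 // => t _; rewrite exprn_ge0.
  by rewrite ltn_eqF // mulr0.
have K0 : 0 <= K by rewrite (le_trans _ (sqr_le 0%N 0%N)) // exprn_ge0.
(* [K + 1] avoids a square root: an entry of norm at least 1 is at most its own square, hence at
   most [K]. *)
exists (K + 1) => [|r s]; first by rewrite lerDr.
have [le1|/ltW ge1] := real_leP (normr_real (B r s)) (@real1 C).
  by rewrite (le_trans le1) // lerDr.
apply: le_trans (_ : K <= _); last by rewrite lerDl ler01.
by apply: le_trans (sqr_le r s); rewrite expr2 ler_peMr.
Qed.

(** * The left-hand side: translates of [B] *)

Section Left.
Variables (B : nat -> nat -> C) (b : nat).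
Hypothesis Bband : banded B b.

Definition shift_matrix (n : nat) (r s : int) : C := Bext B (n%:Z + r) (n%:Z + s).

(** Power 0 is treated apart: extending the identity of the half-line by zero would lose the
    diagonal entries at r < -n. *)
Definition shift_power (n k : nat) (r s : int) : C :=
  if k is 0%N then (r == s)%:R else Bext (npow B k) (n%:Z + r) (n%:Z + s).

Lemma Posz_add_Negz (n i : nat) : (i < n)%N -> n%:Z + Negz i = Posz (n - i.+1).
Proof. by lia. Qed.

Lemma Posz_add_Negz_ge (n i : nat) :
  (n <= i)%N -> n%:Z + Negz i = Negz (i - n).
Proof. by lia. Qed.

(** By the band, the partial sums defining [nmul] are constant from [n] on, so the limit is a finite
    sum. *)
Lemma npowS k r s n : (r + b < n)%N ->
  npow B k.+1 r s = \sum_(t < n) B r t * npow B k t s.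
Proof.
move=> rn; apply: cvgn_lim; apply: (cvgn_eventually_cst (N := n)) => m nm.
apply: (@sum_ord_cutoff _ (fun t => B r t * npow B k t s)) => t.
by rewrite (minn_idPr nm) => nt; rewrite Bband ?mul0r //; left; lia.
Qed.

Lemma shift_power_neg n k (i j : 'I_n) :
  shift_power n k (Negz i) (Negz j) = npow B k (n - i.+1) (n - j.+1).
Proof.
case: k => [|k]; last by rewrite /shift_power !Posz_add_Negz.
rewrite /= -[Negz i == Negz j]/(i == j :> nat); congr (_ %:R).
by have := ltn_ord i; have := ltn_ord j; lia.
Qed.

Lemma shift_power_pos n k (q : nat) (j : 'I_n) :
  shift_power n k q (Negz j) = npow B k (n + q) (n - j.+1).
Proof.
case: k => [|k]; last by rewrite /shift_power !Posz_add_Negz.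
by have jn := ltn_ord j; rewrite /= gtn_eqF //; lia.
Qed.

Lemma npowS_split n k r (j : 'I_n) m : (r + b < n + m)%N ->
  npow B k.+1 r (n - j.+1) =
  \sum_(t < n) Bext B r (n%:Z + Negz t) * shift_power n k (Negz t) (Negz j)
  + \sum_(u < m) Bext B r (n%:Z + u%:Z) * shift_power n k u (Negz j).
Proof.
move=> rm; rewrite (npowS _ _ rm) big_split_ord /=; congr (_ + _); last first.
  by apply: eq_bigr => u _; rewrite shift_power_pos.
rewrite (reindex_inj rev_ord_inj) /=; apply: eq_bigr => t _.
by rewrite shift_power_neg Posz_add_Negz.
Qed.

Lemma shift_banded n : banded_int (shift_matrix n) b.
Proof.
move=> r s rs; rewrite /shift_matrix /Bext.
case rp: (n%:Z + r) => [p|//].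
case sq: (n%:Z + s) => [q|//].
by rewrite Bband //; lia.
Qed.

Lemma Bext_le (beta : C) : 1 <= beta -> (forall r s, `|B r s| <= beta) ->
  forall r s, `|Bext B r s| <= beta.
Proof.
by move=> beta1 Ble [r|r] [s|s]; rewrite /= ?normr0 ?(le_trans ler01).
Qed.

Lemma lhs_term_psum_cvg (beta : C) n z : 1 <= beta ->
  (forall r s, `|B r s| <= beta) ->
  psum (Fps (det_coef (shift_matrix n) b)) z @ \oo --> lhs_term B n z.
Proof.
move=> beta1 Ble.
have -> : lhs_term B n z =
    cexp (- z * \sum_(i < n) shift_matrix n (Negz i) (Negz i)) *
    \det (\matrix_(i < n, j < n) limn (fun K =>
      \sum_(k < K) z ^+ k / k`!%:R * shift_power n k (Negz i) (Negz j))).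
  have -> : \sum_(i < n) shift_matrix n (Negz i) (Negz i) = \sum_(r < n) B r r.
    rewrite [RHS](reindex_inj rev_ord_inj) /=; apply: eq_bigr => i _.
    by rewrite /shift_matrix Posz_add_Negz.
  rewrite /lhs_term; congr (_ * _).
  rewrite (@fdet1_nth _ _ _ 0%N n) ?size_iota //.
  (* [Negz i] translates to coordinate n - 1 - i, so the two matrices differ by reversing rows and
     columns. *)
  rewrite -(det_perm_conj (perm rev_ord_inj)); congr (\det _).
  apply/matrixP => i j; rewrite !mxE !permE !nth_iota // !add0n ltn_ord mulr1.
  rewrite addrC subrK /nexp; apply: (congr1 (fun u : nat -> C => limn u)); apply/funext => K.
  by apply: eq_bigr => k _; rewrite shift_power_neg.
apply: (@det_coef_psum_cvg _ _ _ _ _ beta) => //.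
- exact: shift_banded.
- by move=> i s ni; rewrite /shift_matrix Posz_add_Negz_ge.
- by move=> r s; exact: Bext_le.
- move=> k i j; have ilt := ltn_ord i.
  rewrite shift_power_neg (@npowS_split _ _ _ _ b) /shift_matrix; last by lia.
  by rewrite Posz_add_Negz.
- move=> k q j; rewrite shift_power_pos (@npowS_split _ _ _ _ (q + b).+1) //; lia.
Qed.

End Left.

Lemma big_iota n (F : nat -> C) : \sum_(i <- iota 0 n) F i = \sum_(i < n) F i.
Proof. by rewrite -[n in iota 0 n]subn0 -/(index_iota 0 n) big_mkord. Qed.

(** * The right-hand side: truncations of the right limit *)

Section Right.
Variables (A : int -> int -> C) (b : nat).
Hypothesis Aband : banded_int A b.

Lemma mem_zrange (M : nat) (r : int) : (r \in zrange M) = (`|r| <= M)%N.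
Proof.
apply/mapP/idP => [[i im ->]|rM]; first by move: im; rewrite mem_iota; lia.
by exists (absz (r + M%:Z)); rewrite ?mem_iota; lia.
Qed.

Lemma sum_zrange (M : nat) (F : int -> C) :
  \sum_(t <- zrange M) F t = \sum_(t < M) F (Negz t) + \sum_(u < M.+1) F u.
Proof.
rewrite /zrange; have -> : (2 * M).+1 = (M + M.+1)%N by lia.
rewrite big_map iotaD big_cat big_iota add0n -[M in iota M]addn0 iotaDl.
rewrite big_map big_iota /=; congr (_ + _).
  rewrite (reindex_inj rev_ord_inj) /=; apply: eq_bigr => t _; congr F.
  by have := ltn_ord t; lia.
by apply: eq_bigr => u _; congr F; lia.
Qed.

Lemma trunc_banded M : banded_int (trunc A M) b.
Proof. by move=> r s rs; rewrite /trunc Aband //; case: ifP. Qed.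

Lemma trunc_row0 M (i : nat) s : (M <= i)%N -> trunc A M (Negz i) s = 0.
Proof. by move=> Mi; rewrite /trunc !mem_zrange; case: ifP => //; lia. Qed.

Lemma trunc_col0 M r (u : nat) : (M < u)%N -> trunc A M r u = 0.
Proof. by move=> Mi; rewrite /trunc !mem_zrange; case: ifP => //; lia. Qed.

Lemma trunc_le M (beta : C) : 0 <= beta -> (forall r s, `|A r s| <= beta) ->
  forall r s, `|trunc A M r s| <= beta.
Proof. by move=> b0 Ale r s; rewrite /trunc; case: ifP; rewrite ?normr0. Qed.

Lemma trunc_cvg r s : (fun M => trunc A M r s) @ \oo --> A r s.
Proof.
apply: (cvgn_eventually_cst (N := maxn `|r| `|s|)) => M.
by rewrite geq_max => /andP[rM sM]; rewrite /trunc !mem_zrange rM sM.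
Qed.

(** The cutoff [n] is free so that the band widths required on either side of the cut can replace
    [M.+1]. *)
Lemma zpowS_split M k (r s : int) n :
  (forall u : nat, (n <= u)%N -> trunc A M r u = 0) ->
  zpow A M k.+1 r s =
  \sum_(t < M) trunc A M r (Negz t) * zpow A M k (Negz t) s
  + \sum_(u < n) trunc A M r u * zpow A M k u s.
Proof.
move=> trunc0; rewrite /= sum_zrange; congr (_ + _).
apply: (@sum_ord_cutoff _ (fun u => trunc A M r u * zpow A M k u s)) => u.
by rewrite geq_min => /orP[Mu|nu]; [rewrite trunc_col0|rewrite trunc0];
  rewrite ?mul0r.
Qed.

Lemma rhs_term_psum_cvg (beta : C) M z : 1 <= beta ->
  (forall r s, `|A r s| <= beta) ->
  psum (Fps (det_coef (trunc A M) b)) z @ \oo --> rhs_term A M z.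
Proof.
move=> beta1 Ale.
have -> : rhs_term A M z =
    cexp (- z * \sum_(i < M) trunc A M (Negz i) (Negz i)) *
    \det (\matrix_(i < M, j < M) limn (fun K =>
      \sum_(k < K) z ^+ k / k`!%:R * zpow A M k (Negz i) (Negz j))).
  have -> : \sum_(i < M) trunc A M (Negz i) (Negz i) =
      \sum_(r <- negrange M) trunc A M r r.
    rewrite /negrange big_map big_iota.
    by apply: eq_bigr => i _; rewrite NegzE.
  rewrite /rhs_term; congr (_ * _).
  rewrite (@fdet1_nth _ _ _ 0 M) ?size_map ?size_iota //; congr (\det _).
  apply/matrixP => i j; rewrite !mxE /negrange !(nth_map 0%N) ?size_iota //.
  rewrite !nth_iota // !add0n -!NegzE mulr1 -[Negz i == Negz j]/(i == j :> nat).
  by rewrite addrC subrK.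
apply: (@det_coef_psum_cvg _ _ _ _ _ beta) => //.
- exact: trunc_banded.
- exact: trunc_row0.
- exact: trunc_le (le_trans ler01 beta1) Ale.
- move=> k i j; apply: zpowS_split => u bu; apply: trunc_banded; lia.
- move=> k q j; apply: zpowS_split => u bu; apply: trunc_banded; lia.
Qed.

End Right.

End Links.

Unset Implicit Arguments.

Theorem theorem4p7 (R : realType) (b : nat) (B : nat -> nat -> Cpx R)
    (n : nat -> nat) (BR : int -> int -> Cpx R) :
  banded B b ->
  bounded_nat B ->
  (forall j, (n j < n j.+1)%N) ->
  right_limit B n BR ->
  exists eps : Cpx R, 0 < eps /\
    exists L : Cpx R -> Cpx R,
      unif_cvg_on (cball0 eps) (fun j z => lhs_term B (n j) z) L /\
      unif_cvg_on (cball0 eps) (fun M z => rhs_term BR M z) L /\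
      analytic_on (cball0 eps) L.
Proof.
move=> Bband Bbdd n_incr [Bcvg _].
have [beta beta1 Ble] := bounded_nat_entries Bbdd.
have shift_le j r s : `|shift_matrix B (n j) r s| <= beta by exact: Bext_le.
(* Band and entry bound pass to the entrywise limit, so [BR] and its truncations share the radius
   and majorant of the translates; both families then converge to the series of [BR]. *)
have BRband : banded_int BR b.
  move=> r s rs; rewrite -(cvgn_lim (Bcvg r s)); apply: cvgn_lim.
  apply: (cvgn_eventually_cst (N := 0%N)) => j _.
  exact: (shift_banded Bband (n j) rs).
have BRle r s : `|BR r s| <= beta.
  by apply: (cvgn_norm_le (N := 0%N) (Bcvg r s)) => j _; exact: shift_le.
have BRD := det_coef_le BRband BRle beta1.
exists (cvg_radius b beta); split; first exact: cvg_radius_gt0.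
exists (fun z => limn (psum (Fps (det_coef BR b)) z)); split; last split.
- apply: (det_coef_unif_cvg beta1 (fun j => shift_banded Bband (n j)) shift_le) => //.
  by move=> j z; exact: (@lhs_term_psum_cvg R B b Bband beta (n j) z beta1 Ble).
- apply: (det_coef_unif_cvg beta1 (fun M => trunc_banded BRband M)) => //.
  + by move=> M; exact: (trunc_le _ (le_trans ler01 beta1) BRle).
  + by move=> r s; exact: trunc_cvg.
  + by move=> M z; exact: (@rhs_term_psum_cvg R BR b BRband beta M z beta1 BRle).
- exact: (analytic_psum (a := Fps _) beta1 BRD).
Qed.
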